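(* Let $n\ge3$, $p>1$ and $F(u)=|u|^p$. Assume $f\equiv0$ and $g(x)=g(|x|)$ with $g\in C_0^2([0,\infty))$ such that (i) $\operatorname{supp} g\subset\{x\in\mathbb{R}^n:|x|\le k\}$ for some $k>0$, and (ii) there exists $k_0$ with $0<k_0<k$ such that $g(|x|)>0$ for $k_0<|x|<k$. Then there exist $\varepsilon_0=\varepsilon_0(g,n,p,k)>0$ and a constant $C>0$ independent of $\varepsilon$ such that for all $0<\varepsilon\le\varepsilon_0$, \[ \widehat{T}(\varepsilon)\le C\varepsilon^{-2p(p-1)/\zeta(p,n)}\quad\text{if }1<p<p_1(n),\qquad \widehat{T}(\varepsilon)\le \exp\left(C\varepsilon^{-p(p-1)}\right)\quad\text{if }p=p_1(n). \]
   Context: $\omega_n=2\pi^{n/2}/\Gamma(n/2)$. For $(x,t)\in\mathbb{R}^n\times[0,\infty)$ define $V(x,t)=\frac{1}{\omega_n}\int_{|\omega|=1}\left(\frac{t\,\omega\cdot\nabla f}{n-2}+f+tg\right)(x+t\omega)\,dS_\omega$ and $N(G)(x,t)=\frac{1}{(n-2)\omega_n}\int_0^t(t-\tau)\,d\tau\int_{|\omega|=1}G(x+(t-\tau)\omega,\tau)\,dS_\omega$. The lifespan $\widehat{T}(\varepsilon)$ is the supremum of $t>0$ such that there exists a solution $u$ on $\mathbb{R}^n\times[0,t]$ of the integral equation $u=\varepsilon V+N(F(u))$ (a $C^2$ solution when $p\ge2$, a $C^1$ solution when $1<p<2$). Set $\zeta(p,n)=2\left(1+(n-1)p-(n-2)p^2\right)$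 and $p_1(n)=\frac{n-1+\sqrt{n^2+2n-7}}{2(n-2)}$, the positive root of $\zeta(p,n)=0$. *)

(* Defs.v *)
From HB Require Import structures.
From mathcomp Require Import all_boot all_order all_algebra.
From mathcomp Require Import all_classical all_reals all_analysis.
Set Implicit Arguments. Unset Strict Implicit. Unset Printing Implicit Defensive.
Import Order.TTheory GRing.Theory Num.Theory.
Import numFieldNormedType.Exports.
Local Open Scope classical_set_scope.
Local Open Scope ring_scope.

Section Defs.
Variable R : realType.

(* Euclidean norm on R^n (the library norm on matrices is the sup norm). *)
Definition enorm (n : nat) (x : 'rV[R]_n) : R :=
  Num.sqrt (\sum_(i < n) x ord0 i ^+ 2).

(* Iterated (one-dimensional Lebesgue) integral over R^n; by Fubini this is
   the n-dimensional Lebesgue integral for the (bounded, compactly supported,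
   measurable) integrands used below. *)
Fixpoint intRn (n : nat) : ('rV[R]_n -> R) -> R :=
  match n return ('rV[R]_n -> R) -> R with
  | 0 => fun F => F 0
  | m.+1 => fun F =>
      Rintegral (@lebesgue_measure R) setT
        (fun t : R => intRn (fun y : 'rV[R]_m => F (row_mx (const_mx t : 'rV[R]_1) y)))
  end.

(* Surface integral over the unit sphere S^{n-1} of R^n (w.r.t. the standard
   surface measure dS), via the cone-measure formula
   int_{|w|=1} h(w) dS_w = n * int_{|y|<=1} h(y/|y|) dy. *)
Definition sphint (n : nat) (h : 'rV[R]_n -> R) : R :=
  n%:R * intRn (fun y : 'rV[R]_n =>
                  if enorm y <= 1 then h ((enorm y)^-1 *: y) else 0).

Definition Gamma (s : R) : R :=
  Rintegral (@lebesgue_measure R) `]0, +oo[%classic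
    (fun x => x `^ (s - 1) * expR (- x)).

Definition omega (n : nat) : R :=
  2 * pi `^ (n%:R / 2) / Gamma (n%:R / 2).

(* V(x,t); the term omega . grad f is the directional derivative 'D_w f. *)
Definition Vlin (n : nat) (f g : 'rV[R]_n -> R) (x : 'rV[R]_n) (t : R) : R :=
  (omega n)^-1 * sphint (fun w : 'rV[R]_n =>
     t * ('D_w f (x + t *: w)) / (n%:R - 2) + f (x + t *: w)
     + t * g (x + t *: w)).

Definition Nop (n : nat) (G : 'rV[R]_n -> R -> R) (x : 'rV[R]_n) (t : R) : R :=
  ((n%:R - 2) * omega n)^-1 *
  Rintegral (@lebesgue_measure R) `[0, t]%classic
    (fun tau => (t - tau) *
       sphint (fun w : 'rV[R]_n => G (x + (t - tau) *: w) tau)).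

Definition lift_xt (n : nat) (u : 'rV[R]_n -> R -> R) : 'rV[R]_(1 + n) -> R :=
  fun z => u (rsubmx z) (lsubmx z ord0 ord0).

Definition C1_on (m : nat) (w : 'rV[R]_m -> R) (O : set 'rV[R]_m) : Prop :=
  (forall z, O z -> {for z, continuous w}) /\
  (forall v z, O z -> derivable w z v) /\
  (forall v z, O z -> {for z, continuous ('D_v w)}).

Definition C2_on (m : nat) (w : 'rV[R]_m -> R) (O : set 'rV[R]_m) : Prop :=
  C1_on w O /\ (forall v, C1_on ('D_v w) O).

(* u is C^k on R^n x [0,T]  (k = 2 if p >= 2, k = 1 if 1 < p < 2),
   understood as C^k on an open slab R^n x (-delta, T + delta). *)
Definition regular_sol (n : nat) (p T : R) (u : 'rV[R]_n -> R -> R) : Prop :=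
  exists2 delta : R, 0 < delta &
    let O := [set z : 'rV[R]_(1 + n) | - delta < lsubmx z ord0 ord0 < T + delta] in
    if 2 <= p then C2_on (lift_xt u) O else C1_on (lift_xt u) O.

Definition is_solution (n : nat) (p eps : R) (f g : 'rV[R]_n -> R) (T : R)
  (u : 'rV[R]_n -> R -> R) : Prop :=
  regular_sol p T u /\
  forall x t, 0 <= t <= T ->
    u x t = eps * Vlin f g x t + Nop (fun y s => `|u y s| `^ p) x t.

Definition lifespan (n : nat) (p eps : R) (f g : 'rV[R]_n -> R) : \bar R :=
  ereal_sup [set t%:E | t in
    [set t : R | 0 < t /\ exists u, is_solution p eps f g t u]].

Definition zeta (p : R) (n : nat) : R :=
  2 * (1 + (n%:R - 1) * p - (n%:R - 2) * p ^+ 2).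

Definition p1 (n : nat) : R :=
  (n%:R - 1 + Num.sqrt (n%:R ^+ 2 + 2 * n%:R - 7)) / (2 * (n%:R - 2)).

Definition C2_halfline (g0 : R -> R) : Prop :=
  exists G : R -> R,
    (forall r, derivable G r 1) /\ (forall r, derivable (derive1 G) r 1) /\
    continuous (derive1 (derive1 G)) /\ (forall r, 0 <= r -> G r = g0 r).

End Defs.

(* Main.v *)
(** Only pointwise lower bounds are iterated; no spherical averaging is needed.
    For [t - |x| > k0] the free term is nonnegative, so [u >= N(|u|^p)] there,
    and [u >= c eps t^(2-n)] on a strip [a <= t - |x| <= b].  Integrating along
    the backward null rays that cross a strip [b1 <= t - |x| <= b2] turns a bound
    [u >= K] on the strip into [u >= c K^p (b2 - b1) L] in the interior cone
    [|x| <= L - t], [3L/4 <= t <= L].  Inside that cone the sphere means of a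
    function of [t] are trivial, so the inequality becomes [w'' >= c w^p] and [u]
    blows up before time [L] as soon as [M^(p-1) L^2] is large, [M] being the
    interior bound.  With the initial strip this is exactly the subcritical bound.
    If [p = p_1(n)], put [m = n - 2] and [q = m p - m - 1], so that [p q = 1].
    Then a bound [u >= Y |x|^(-m) (t-|x|)^(-q)] for [t - |x| >= s] improves to
    [c D Y^p] in place of [Y] for [t - |x| >= 4 2^D s]: each of the [D] dyadic
    values of [t - |y|] contributes equally.  Doubling [Y] from [c eps^p] up to a
    fixed threshold thus costs a total of [O(eps^(-p(p-1)))] in [log s].
    The integral of a nonnegative function is a supremum over simple functions,
    hence monotone and superadditive on bounded functions of bounded support even
    without measurability, which is all that lower bounds need. *)

Require Import Defs.
From HB Require Import structures.
From mathcomp Require Import all_boot all_order all_algebra.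
From mathcomp Require Import all_classical all_reals all_analysis.
From mathcomp Require Import ring lra.
Import Order.TTheory GRing.Theory Num.Theory.
Import numFieldNormedType.Exports.
Local Open Scope classical_set_scope.
Local Open Scope ring_scope.

Set Implicit Arguments. Unset Strict Implicit. Unset Printing Implicit Defensive.

(** * Iterated lower integrals *)

Section LowerIntegral.
Local Open Scope ereal_scope.
Context d (T : measurableType d) (R : realType)
        (mu : {measure set T -> \bar R}).
Import HBNNSimple.

Lemma ge0_le_integral_nonmeasurable (f g : T -> \bar R) :
  (forall x, 0 <= f x) -> (forall x, f x <= g x) ->
  \int[mu]_x f x <= \int[mu]_x g x.
Proof.
move=> f0 fg; have g0 x : 0 <= g x by exact: le_trans (fg x).
rewrite !ge0_integralTE//; apply: ge_ereal_sup => _ [h /= hf <-].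
by apply: ereal_sup_ubound; exists h => // x; exact: le_trans (fg x).
Qed.

Lemma ge0_integral_superadd (f g : T -> \bar R) :
  (forall x, 0 <= f x) -> (forall x, 0 <= g x) ->
  \int[mu]_x f x \is a fin_num -> \int[mu]_x g x \is a fin_num ->
  \int[mu]_x f x + \int[mu]_x g x <= \int[mu]_x (f x + g x).
Proof.
move=> f0 g0.
have fg0 x : 0 <= f x + g x by exact: adde_ge0.
rewrite !ge0_integralTE// => If Ig; apply/lee_addgt0Pr => e e0.
have e20 : (0 < e / 2)%R by rewrite divr_gt0.
have [_ [h /= hf <-] hI] := ub_ereal_sup_adherent e20 If.
have [_ [k /= kg <-] kI] := ub_ereal_sup_adherent e20 Ig.
apply: (@le_trans _ _ (sintegral mu (h \+ k)%R + e%:E)); last first.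
  rewrite leeD2r//; apply: ereal_sup_ubound => /=.
  exists (add_nnsfun h k) => // x.
  by rewrite EFinD leeD.
rewrite sintegralD//.
 rewrite (splitr e) EFinD addeACA.
by apply: leeD; rewrite -leeBlDr// ltW.
Qed.
End LowerIntegral.

Section IntRn.
Variable R : realType.
Local Notation mu := (@lebesgue_measure R).

Lemma lebesgue_integral_itv_cst (a b c : R) : a <= b ->
  (\int[mu]_x (if (a <= x < b)%R then c else 0)%:E = (c * (b - a))%:E)%E.
Proof.
move=> ab.
rewrite (_ : (fun x => _) = (cst c%:E) \_ (`[a, b[%classic : set R)).
  rewrite -integral_mkcond integral_cst//= lebesgue_measure_itv/=.
  rewrite lte_fin -EFinD; move: ab; rewrite le_eqVlt => /predU1P[->|->].
    by rewrite ltxx mule0 subrr mulr0.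
  by rewrite EFinM.
apply/funext => x; rewrite patchE mem_setE in_itv/=.
by case: ifP.
Qed.

(* For such [f] the integral defining [Rintegral] is a finite lower integral,
   so monotonicity and superadditivity need no measurability. *)
Definition bdsupp1 (f : R -> R) := exists K L : R, 0 <= L /\
  forall x, 0 <= f x <= (if - L <= x < L then K else 0).

Lemma bdsupp1_fin f : bdsupp1 f ->
  (\int[mu]_x (f x)%:E)%E \is a fin_num.
Proof.
move=> [K [L [L0 Hf]]]; rewrite ge0_fin_numE; last first.
  by apply: integral_ge0 => x _; rewrite lee_fin; case/andP: (Hf x).
apply: (@le_lt_trans _ _ (\int[mu]_x (if (- L <= x < L)%R then K else 0)%:E)%E).
  by apply: ge0_le_integral_nonmeasurable => x; rewrite lee_fin; case/andP: (Hf x).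
by rewrite lebesgue_integral_itv_cst ?ltry// ge0_cp.
Qed.

Lemma bdsupp1_le f g : bdsupp1 g -> (forall x, 0 <= f x <= g x) -> bdsupp1 f.
Proof.
move=> [K [L [L0 H]]] fg; exists K, L; split => // x.
have /andP[-> h] := fg x; have /andP[_ h'] := H x; exact: le_trans h'.
Qed.

Lemma bdsupp1D f g : bdsupp1 f -> bdsupp1 g -> bdsupp1 (f \+ g).
Proof.
move=> [K [L [L0 H]]] [K' [L' [L'0 H']]].
exists (`|K| + `|K'|), (Num.max L L'); split; first by rewrite le_max L0.
move=> x /=; have /andP[f0 fK] := H x; have /andP[g0 gK] := H' x.
rewrite addr_ge0//=.
have wid M : M <= Num.max L L' -> - M <= x < M ->
    - Num.max L L' <= x < Num.max L L'.
  by move=> ML /andP[h1 h2]; rewrite (le_trans _ h1) ?lerN2// (lt_le_trans h2).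
move: fK gK.
have := ler_norm K; have := ler_norm K'; have := normr_ge0 K; have := normr_ge0 K'.
case: (boolP (- Num.max L L' <= x < _)) => [_|out].
  by case: ifP => ?; case: ifP => ?; lra.
do 2 (case: ifPn => [/wid|_]; first by rewrite le_max lexx ?orbT => /(_ isT); rewrite (negPf out)).
lra.
Qed.

Lemma Rintegral_le f g : bdsupp1 g -> (forall x, 0 <= f x <= g x) ->
  Rintegral mu setT f <= Rintegral mu setT g.
Proof.
move=> bg fg; have bf := bdsupp1_le bg fg.
apply: fine_le; [exact: bdsupp1_fin|exact: bdsupp1_fin|].
by apply: ge0_le_integral_nonmeasurable => x; rewrite lee_fin; case/andP: (fg x).
Qed.

Lemma Rintegral_superadd f g : bdsupp1 f -> bdsupp1 g ->
  Rintegral mu setT f + Rintegral mu setT g <= Rintegral mu setT (f \+ g).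
Proof.
move=> bf bg; have ff := bdsupp1_fin bf; have gf := bdsupp1_fin bg.
rewrite /Rintegral -fineD//; apply: fine_le.
- by rewrite fin_numD ff.
- by apply: (bdsupp1_fin); exact: bdsupp1D.
- under [leRHS]eq_integral do rewrite EFinD.
  apply: ge0_integral_superadd => // x; rewrite lee_fin.
    by have [? [? [_ /(_ x)/andP[]]]] := bf.
  by have [? [? [_ /(_ x)/andP[]]]] := bg.
Qed.

Lemma Rintegral_itv_cst (a b c : R) : a <= b ->
  Rintegral mu setT (fun x => if a <= x < b then c else 0) = c * (b - a).
Proof. by move=> ab; rewrite /Rintegral lebesgue_integral_itv_cst. Qed.

Definition inbox n (a b : 'I_n -> R) (y : 'rV[R]_n) :=
  [forall i, a i <= y ord0 i < b i].

Definition bdsupp n (F : 'rV[R]_n -> R) := exists K L : R, 0 <= L /\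
  forall y, 0 <= F y <= (if inbox (fun=> - L) (fun=> L) y then K else 0).

Lemma intRn_ge0 n (F : 'rV[R]_n -> R) : (forall y, 0 <= F y) -> 0 <= intRn F.
Proof.
elim: n F => [F F0|n IH F F0] /=; first exact: F0.
by apply: Rintegral_ge0 => t _; exact: IH.
Qed.

Lemma inbox_row n (a b : 'I_n.+1 -> R) (t : R) (y : 'rV[R]_n) :
  inbox a b (row_mx (const_mx t : 'rV[R]_1) y : 'rV_(1 + n)) =
  (a ord0 <= t < b ord0) &&
  inbox (fun i => a (lift ord0 i)) (fun i => b (lift ord0 i)) y.
Proof.
have e0 : (row_mx (const_mx t : 'rV[R]_1) y : 'rV_(1 + n)) ord0 ord0 = t.
  by rewrite (_ : ord0 = lshift n (ord0 : 'I_1)) ?row_mxEl ?mxE//; exact: val_inj.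
have eS i : (row_mx (const_mx t : 'rV[R]_1) y : 'rV_(1 + n)) ord0 (lift ord0 i) = y ord0 i.
  by rewrite (_ : lift ord0 i = rshift 1 i) ?row_mxEr//; exact: val_inj.
apply/forallP/andP => [H|[H0 /forallP H] i].
  split; first by have := H ord0; rewrite e0.
  by apply/forallP => i; have := H (lift ord0 i); rewrite eS.
case: (unliftP ord0 i) => [j ->|->]; last by rewrite e0.
by rewrite eS.
Qed.

Lemma intRn_box n (a b : 'I_n -> R) c : (forall i, a i <= b i) ->
  intRn (fun y => if inbox a b y then c else 0) = c * \prod_i (b i - a i).
Proof.
elim: n a b c => [a b c _|n IH a b c ab].
  by rewrite big_ord0 mulr1 /=; case: ifP => // /negP[]; apply/forallP; case.
rewrite [LHS]/=.
rewrite (_ : (fun t : R => _) = fun t => if a ord0 <= t < b ord0 then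
  c * \prod_i (b (lift ord0 i) - a (lift ord0 i)) else 0).
  by rewrite Rintegral_itv_cst// big_ord_recl mulrAC mulrA.
apply/funext => t; under eq_fun do rewrite inbox_row.
case: ifP => _ /=; first by rewrite -IH.
by rewrite -[LHS]/(intRn (fun=> 0)) -[RHS](@mul0r _ (\prod_(i < n) (1 - 0))) -IH;
  [congr intRn; apply/funext => y; case: ifP|].
Qed.

Lemma bdsupp_le n (F G : 'rV[R]_n -> R) :
  bdsupp G -> (forall y, 0 <= F y <= G y) -> bdsupp F.
Proof.
move=> [K [L [L0 H]]] fg; exists K, L; split => // x.
have /andP[-> h] := fg x; have /andP[_ h'] := H x; exact: le_trans h'.
Qed.

Lemma bdsupp_slice n (F : 'rV[R]_n.+1 -> R) (t : R) : bdsupp F ->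
  bdsupp (fun y : 'rV[R]_n => F (row_mx (const_mx t : 'rV[R]_1) y)).
Proof.
move=> [K [L [L0 H]]]; exists `|K|, L; split => // y.
have /andP[-> h] := H (row_mx (const_mx t : 'rV[R]_1) y).
rewrite (le_trans h)// inbox_row /=.
by case: (inbox _ _ y); rewrite ?andbF// andbT; case: ifP; rewrite ?ler_norm.
Qed.

Let slice n (F : 'rV[R]_n.+1 -> R) (t : R) (y : 'rV[R]_n) :=
  F (row_mx (const_mx t : 'rV[R]_1) y).

Let bdsupp1_slice n :
  (forall F G : 'rV[R]_n -> R, bdsupp G -> (forall y, 0 <= F y <= G y) ->
    intRn F <= intRn G) ->
  forall F : 'rV[R]_n.+1 -> R, bdsupp F -> bdsupp1 (fun t => intRn (slice F t)).
Proof.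
move=> IH F [K [L [L0 H]]].
exists (`|K| * \prod_(i < n) (L - - L)), L; split => // t.
rewrite intRn_ge0/= => [|y]; last by case/andP: (H (row_mx (const_mx t : 'rV_1) y)).
rewrite -intRn_box; last by move=> ?; rewrite ge0_cp.
rewrite [leRHS](_ : _ = intRn (fun y : 'rV[R]_n => if inbox (fun=> - L) (fun=> L)
  (row_mx (const_mx t : 'rV_1) y : 'rV_(1 + n)) then `|K| else 0)).
  apply: IH => [|y].
    exists `|K|, L; split => // y; rewrite inbox_row/=.
    by case: ifP => [/andP[_ ->]|_]; [|case: ifP]; rewrite ?normr_ge0 ?lexx.
  have /andP[h0 h] := H (row_mx (const_mx t : 'rV[R]_1) y).
  rewrite h0 (le_trans h)//.
  by case: ifP; rewrite ?ler_norm.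
case: ifP => tL; first by congr intRn; apply/funext => y; rewrite inbox_row/= tL.
rewrite [RHS](_ : _ = intRn (fun y : 'rV[R]_n => if inbox (fun=> - L) (fun=> L) y then 0 else 0)).
  by rewrite intRn_box ?mul0r// => ?; rewrite ge0_cp.
by congr intRn; apply/funext => y; rewrite inbox_row/= tL; case: ifP.
Qed.

Lemma intRn_le n (F G : 'rV[R]_n -> R) :
  bdsupp G -> (forall y, 0 <= F y <= G y) -> intRn F <= intRn G.
Proof.
elim: n F G => [F G _ FG|n IH F G bG FG]; first by case/andP: (FG 0).
apply: Rintegral_le => [|t]; first exact: bdsupp1_slice.
rewrite intRn_ge0/= => [|y]; last by case/andP: (FG (row_mx (const_mx t : 'rV_1) y)).
by apply: IH => //; exact: bdsupp_slice.
Qed.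

Lemma bdsupp_intRn_slice n (F : 'rV[R]_n.+1 -> R) : bdsupp F ->
  bdsupp1 (fun t => intRn (fun y : 'rV[R]_n => F (row_mx (const_mx t : 'rV[R]_1) y))).
Proof. by apply: bdsupp1_slice; exact: intRn_le. Qed.

Lemma bdsuppD n (F G : 'rV[R]_n -> R) : bdsupp F -> bdsupp G -> bdsupp (F \+ G).
Proof.
move=> [K [L [L0 H]]] [K' [L' [L'0 H']]].
exists (`|K| + `|K'|), (Num.max L L'); split; first by rewrite le_max L0.
move=> y /=; have /andP[f0 fK] := H y; have /andP[g0 gK] := H' y.
rewrite addr_ge0//=.
have wid M : M <= Num.max L L' -> inbox (fun=> - M) (fun=> M) y ->
    inbox (fun=> - Num.max L L') (fun=> Num.max L L') y.
  move=> ML /forallP h; apply/forallP => i; have /andP[h1 h2] := h i.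
  by rewrite (le_trans _ h1) ?lerN2// (lt_le_trans h2).
move: fK gK.
have := ler_norm K; have := ler_norm K'; have := normr_ge0 K; have := normr_ge0 K'.
case: (boolP (inbox (fun=> - Num.max L L') _ y)) => [_|out].
  by case: ifP => ?; case: ifP => ?; lra.
do 2 (case: ifPn => [/wid|_]; first by rewrite le_max lexx ?orbT => /(_ isT); rewrite (negPf out)).
lra.
Qed.

Lemma intRn_superadd n (F G : 'rV[R]_n -> R) : bdsupp F -> bdsupp G ->
  intRn F + intRn G <= intRn (F \+ G).
Proof.
elim: n F G => [//|n IH F G bF bG].
have bFG := bdsuppD bF bG.
apply: le_trans (Rintegral_superadd (bdsupp_intRn_slice bF) (bdsupp_intRn_slice bG)) _.
apply: Rintegral_le; first exact: bdsupp_intRn_slice.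
move=> t /=; rewrite IH ?andbT; try exact: bdsupp_slice.
have [K [L [_ H]]] := bF; have [K' [L' [_ H']]] := bG.
by rewrite addr_ge0// intRn_ge0// => y;
  [case/andP: (H (row_mx (const_mx t : 'rV_1) y))
  |case/andP: (H' (row_mx (const_mx t : 'rV_1) y))].
Qed.

Lemma intRn_cst0 n : intRn (fun _ : 'rV[R]_n => 0) = 0.
Proof.
rewrite -[RHS](mul0r (\prod_(i < n) (0 - 0 : R))) -intRn_box//.
by congr intRn; apply/funext => y; case: ifP.
Qed.

Lemma ler_sum_intRn n (I : Type) (s : seq I) (G : I -> 'rV[R]_n -> R) F :
  bdsupp F -> (forall i y, 0 <= G i y) ->
  (forall y, \sum_(i <- s) G i y <= F y) ->
  \sum_(i <- s) intRn (G i) <= intRn F.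
Proof.
move=> bF G0; elim: s F bF => [|i s IH] F bF GF.
  rewrite big_nil intRn_ge0// => y; have := GF y; by rewrite big_nil.
have GF' y : G i y + \sum_(j <- s) G j y <= F y by have := GF y; rewrite big_cons.
have S0 y : 0 <= \sum_(j <- s) G j y by rewrite sumr_ge0.
have bG : bdsupp (G i).
  by apply: bdsupp_le bF _ => y; rewrite G0 (le_trans _ (GF' y))// lerDl.
have bS : bdsupp (fun y => \sum_(j <- s) G j y).
  by apply: bdsupp_le bF _ => y; rewrite S0 (le_trans _ (GF' y))// lerDr.
rewrite big_cons (le_trans (lerD (lexx _) (IH _ bS (fun=> lexx _))))//.
apply: le_trans (intRn_superadd bG bS) _; apply: intRn_le => [//|y].
by rewrite /= GF' andbT; apply: addr_ge0.
Qed.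

End IntRn.

(** * Euclidean geometry and cones over spherical caps *)

Section Enorm.
Variables (R : realType) (n : nat).
Implicit Types x y z : 'rV[R]_n.

Lemma enorm_ge0 x : 0 <= enorm x. Proof. exact: sqrtr_ge0. Qed.

Lemma enorm_sqr x : enorm x ^+ 2 = \sum_i x ord0 i ^+ 2.
Proof. by rewrite sqr_sqrtr// sumr_ge0// => i _; rewrite sqr_ge0. Qed.

Lemma enorm0 : enorm (0 : 'rV[R]_n) = 0.
Proof. by rewrite /enorm big1 ?sqrtr0// => i _; rewrite mxE expr0n. Qed.

Lemma enormZ a x : enorm (a *: x) = `|a| * enorm x.
Proof.
rewrite /enorm -sqrtr_sqr -sqrtrM ?sqr_ge0// mulr_sumr; congr Num.sqrt.
by apply: eq_bigr => i _; rewrite mxE exprMn.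
Qed.

Lemma enormN x : enorm (- x) = enorm x.
Proof. by rewrite -scaleN1r enormZ normrN1 mul1r. Qed.

Lemma le_coord_enorm x i : `|x ord0 i| <= enorm x.
Proof.
rewrite -sqrtr_sqr ler_wsqrtr// (bigD1 i)//= lerDl sumr_ge0// => j _.
exact: sqr_ge0.
Qed.

Lemma enorm_eq0 x : enorm x = 0 -> x = 0.
Proof.
move=> x0; apply/rowP => i; rewrite mxE; apply/eqP; rewrite -normr_eq0.
by rewrite eq_le normr_ge0 -x0 le_coord_enorm.
Qed.

Lemma dot_le_enorm x y : \sum_i x ord0 i * y ord0 i <= enorm x * enorm y.
Proof.
have [/enorm_eq0->|x0] := eqVneq (enorm x) 0.
  by rewrite enorm0 mul0r big1// => i _; rewrite mxE mul0r.
have [/enorm_eq0->|y0] := eqVneq (enorm y) 0.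
  by rewrite enorm0 mulr0 big1// => i _; rewrite mxE mulr0.
have px : 0 < enorm x by rewrite lt_def x0 enorm_ge0.
have py : 0 < enorm y by rewrite lt_def y0 enorm_ge0.
rewrite -(@ler_pM2l _ (2 * (enorm x * enorm y))) ?mulr_gt0// mulr_sumr.
rewrite [leRHS](_ : _ = \sum_i (enorm y ^+ 2 * x ord0 i ^+ 2 + enorm x ^+ 2 * y ord0 i ^+ 2)).
  apply: ler_sum => i _; rewrite -subr_ge0.
  by rewrite (_ : _ - _ = (enorm y * x ord0 i - enorm x * y ord0 i) ^+ 2) ?sqr_ge0//; ring.
by rewrite big_split/= -!mulr_sumr -!enorm_sqr; ring.
Qed.

Lemma ler_enormD x y : enorm (x + y) <= enorm x + enorm y.
Proof.
rewrite -(@ler_pXn2r _ 2)// ?nnegrE ?addr_ge0 ?enorm_ge0//.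
rewrite enorm_sqr sqrrD !enorm_sqr.
rewrite [leLHS](_ : _ = \sum_i x ord0 i ^+ 2 + \sum_i y ord0 i ^+ 2 +
   2 * \sum_i x ord0 i * y ord0 i); last first.
  by rewrite mulr_sumr -!big_split; apply: eq_bigr => i _ /=; rewrite mxE; ring.
by have := dot_le_enorm x y; lra.
Qed.

Lemma ler_enormB x y : enorm x - enorm y <= enorm (x - y).
Proof. by rewrite lerBlDr (le_trans _ (ler_enormD _ _))// subrK. Qed.

Lemma enormBC x y : enorm (x - y) = enorm (y - x).
Proof. by rewrite -enormN opprB. Qed.

Lemma enorm_le_coord x a : 0 <= a -> (forall i, `|x ord0 i| <= a) -> enorm x <= n%:R * a.
Proof.
move=> a0 xa; rewrite -(@ler_pXn2r _ 2)// ?nnegrE ?enorm_ge0 ?mulr_ge0//.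
rewrite enorm_sqr; apply: (@le_trans _ _ (\sum_(i < n) a ^+ 2)).
  by apply: ler_sum => i _; rewrite -real_normK ?num_real// ler_pXn2r// nnegrE.
rewrite sumr_const card_ord exprMn -[leLHS]mulr_natl ler_wpM2r ?sqr_ge0//.
by rewrite -natrX ler_nat; case: (n) => // m; rewrite expnS expn1 leq_pmulr.
Qed.

Lemma enorm_normalize x : x != 0 -> enorm ((enorm x)^-1 *: x) = 1.
Proof.
move=> x0; have e0 : enorm x != 0 by apply: contra_neq x0; exact: enorm_eq0.
by rewrite enormZ ger0_norm ?invr_ge0 ?enorm_ge0// mulVf.
Qed.

Lemma normalizeB (x y : 'rV[R]_n) : x != 0 -> y != 0 ->
  enorm ((enorm x)^-1 *: x - (enorm y)^-1 *: y) <= 2 / enorm x * enorm (x - y).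
Proof.
move=> x0 y0.
have ex : 0 < enorm x.
  by rewrite lt_def enorm_ge0 andbT; apply: contra_neq x0; exact: enorm_eq0.
have ey : 0 < enorm y.
  by rewrite lt_def enorm_ge0 andbT; apply: contra_neq y0; exact: enorm_eq0.
have -> : (enorm x)^-1 *: x - (enorm y)^-1 *: y =
    (enorm x)^-1 *: ((x - y) + (enorm y - enorm x) *: ((enorm y)^-1 *: y)).
  rewrite scalerDr scalerA scalerBr scalerA -addrA; congr (_ + _).
  rewrite -scaleNr -scalerDl -scaleNr; congr (_ *: _).
  by field; rewrite !gt_eqF.
rewrite enormZ ger0_norm; last by rewrite invr_ge0 ltW.
rewrite [2 / _]mulrC -mulrA ler_pM2l ?invr_gt0//.
rewrite (le_trans (ler_enormD _ _))// enormZ enorm_normalize// mulr1 mulr2n mulrDl mul1r lerD2l.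
rewrite ler_norml; have := ler_enormB x y; have := ler_enormB y x.
by rewrite (enormBC y x); lra.
Qed.

End Enorm.

Section Grid.
Variables (R : realType) (n : nat).

Definition pairup (t : R) (y : 'rV[R]_n) : 'rV[R]_n.+1 :=
  row_mx (const_mx t : 'rV[R]_1) y.

Lemma pairupE (z : 'rV[R]_n.+1) : exists t y, z = pairup t y.
Proof.
exists ((z : 'rV_(1 + n)) ord0 ord0), (rsubmx (z : 'rV_(1 + n))).
apply: etrans (esym (@hsubmxK _ 1 1 n z)) _.
suff -> : lsubmx (z : 'rV_(1 + n)) = const_mx ((z : 'rV_(1 + n)) ord0 ord0) by [].
apply/rowP => i.
by rewrite ord1 !mxE; congr (z _ _); exact: val_inj.
Qed.

Definition cube (a : 'I_n -> R) (d : R) : pred 'rV[R]_n :=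
  inbox a (fun i => a i + d).

(* Replaces Fubini: the position of the time interval may depend on [y]. *)
Lemma grid_le_intRn (F : 'rV[R]_n.+1 -> R) (a : 'I_n -> R) (d l c eta : R) :
  bdsupp F -> 0 < d -> 0 <= l -> 0 <= c -> 0 < eta ->
  (forall y, cube a d y -> exists al, forall t y', al <= t < al + l ->
    cube a d y' -> (forall i, `|y' ord0 i - y ord0 i| <= eta) ->
    c <= F (pairup t y')) ->
  c * l * d ^+ n <= intRn F.
Proof.
move=> bF d0 l0 c0 eta0 H.
have F0 z : 0 <= F z by have [? [? [_ /(_ z)/andP[]]]] := bF.
pose K := (Num.truncn (d / eta)).+1.
have K0 : 0 < K%:R :> R by rewrite ltr0n.
pose h := d / K%:R.
have h0 : 0 < h by rewrite divr_gt0.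
have hK : K%:R * h = d by rewrite mulrC divfK// gt_eqF.
have heta : h <= eta.
  by rewrite ler_pdivrMr// mulrC -ler_pdivrMr// ltW// truncnS_gt.
pose low (m : {ffun 'I_n -> 'I_K}) i := a i + (m i)%:R * h.
pose corner m : 'rV[R]_n := \row_i low m i.
have cornerQ m : cube a d (corner m).
  apply/forallP => i; rewrite mxE /low lerDl mulr_ge0 ?(ltW h0)//= ltrD2l -hK ltr_pM2r//.
  by rewrite ltr_nat.
have [al Hal] : {al : {ffun 'I_n -> 'I_K} -> R | forall m t y', al m <= t < al m + l ->
    cube a d y' -> (forall i, `|y' ord0 i - corner m ord0 i| <= eta) ->
    c <= F (pairup t y')}.
  have := fun m => cid (H _ (cornerQ m)).
  by move=> f; exists (fun m => projT1 (f m)) => m; case: (f m).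
pose A m (i : 'I_n.+1) := if unlift ord0 i is Some j then low m j else al m.
pose B m (i : 'I_n.+1) := if unlift ord0 i is Some j then low m j + h else al m + l.
have inAB m t y : inbox (A m) (B m) (pairup t y) =
    (al m <= t < al m + l) && cube (low m) h y.
  rewrite inbox_row /A /B unlift_none; congr (_ && _).
  by apply: eq_forallb => i; rewrite liftK.
have disj m m' y : cube (low m) h y -> cube (low m') h y -> m = m'.
  move=> /forallP p /forallP p'; apply/ffunP => i; apply: val_inj => /=.
  have := p i; have := p' i; rewrite /low => /andP[p1 p2] /andP[p3 p4].
  have e (u v : nat) : a i + u%:R * h < a i + v%:R * h + h -> (u <= v)%N.
    rewrite -addrA ltrD2l -{3}[h]mul1r -mulrDl ltr_pM2r// natr1 ltr_nat ltnS//.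
  apply/eqP; rewrite eqn_leq; apply/andP; split; apply: e.
    exact: le_lt_trans p2.
  exact: le_lt_trans p4.
apply: (@le_trans _ _ (\sum_(m : {ffun 'I_n -> 'I_K})
    intRn (fun z => if inbox (A m) (B m) z then c else 0))).
  rewrite (eq_bigr (fun=> c * (l * h ^+ n))) => [|m _].
    rewrite sumr_const card_ffun !card_ord -[leRHS]mulr_natl natrX.
    by rewrite -hK exprMn le_eqVlt; apply/orP; left; apply/eqP; ring.
  rewrite intRn_box.
    rewrite big_ord_recl /A /B unlift_none; congr (_ * (_ * _)); first by rewrite addrC addKr.
    rewrite (eq_bigr (fun=> h)) ?prodr_const ?card_ord// => i _.
    by rewrite liftK addrC addKr.
  by move=> i; rewrite /A /B; case: unlift => [j|]; rewrite lerDl// ltW.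
apply: ler_sum_intRn => // [m z|z]; first by case: ifP.
have [t [y ->]] := pairupE z; under eq_bigr do rewrite inAB.
have [[m /andP[tm ym]]|no] := pselect (exists m, (al m <= t < al m + l) && cube (low m) h y).
  rewrite (bigD1 m)//= tm ym/= big1 ?addr0 => [|m' m'm].
    apply: (Hal m) => // [|i].
      apply/forallP => i; have /forallP/(_ i)/andP[y1 y2] := ym.
      apply/andP; split; first by apply: le_trans y1; rewrite lerDl mulr_ge0// ltW.
      apply: lt_le_trans y2 _.
      rewrite /low -addrA lerD2l -{2}[h]mul1r -mulrDl -hK ler_pM2r// natr1 ler_nat.
      exact: ltn_ord.
    have /forallP/(_ i)/andP[y1 y2] := ym.
    by rewrite mxE ger0_norm ?subr_ge0// (le_trans _ heta)// lerBlDl ltW.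
  case: ifP => // /andP[_ ym']; by rewrite (disj _ _ _ ym' ym) eqxx in m'm.
rewrite big1// => m _; case: ifP => // h'; by case: no; exists m.
Qed.

End Grid.

Lemma natr_dist_lt1 (R : realDomainType) (a b : nat) :
  `|a%:R - b%:R| < 1 :> R -> a = b.
Proof.
rewrite ltr_norml => /andP[h1 h2]; apply/eqP; rewrite eqn_leq.
by apply/andP; split; rewrite -ltnS -(ltr_nat R) -[_.+1%:R]natr1; lra.
Qed.

Section Cap.
Variables (R : realType) (n : nat).
Hypothesis n0 : (0 < n)%N.

Definition capcone (w : 'rV[R]_n) (th : R) (y : 'rV[R]_n) :=
  [/\ 1 / 8 <= enorm y, enorm y <= 1 & enorm ((enorm y)^-1 *: y - w) <= th].

Definition capc : R := ((16 * n%:R) ^+ n.-1 * (4 * n%:R))^-1.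

Lemma n_gt0R : 0 < n%:R :> R. Proof. by rewrite ltr0n. Qed.

Lemma capc_gt0 : 0 < capc.
Proof. by rewrite invr_gt0 mulr_gt0 ?exprn_gt0 ?mulr_gt0 ?n_gt0R. Qed.

Lemma cap_cubes (w : 'rV[R]_n) (th : R) : enorm w = 1 -> 0 < th <= 1 ->
  exists d (N : nat) (A : nat -> 'I_n -> R), [/\ 0 < d,
    capc * th ^+ n.-1 <= N%:R * d ^+ n,
    forall m y, (m < N)%N -> cube (A m) d y -> capcone w th y &
    forall m m' y, cube (A m) d y -> cube (A m') d y -> m = m'].
Proof.
move=> w1 /andP[th0 th1].
have nR := n_gt0R.
have n1 : 1 <= n%:R :> R by rewrite ler1n.
pose d := th / (16 * n%:R).
have d0 : 0 < d by rewrite divr_gt0// mulr_gt0.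
pose h := n%:R * d.
have h0 : 0 < h by rewrite mulr_gt0.
have hth : h = th / 16 by rewrite /h /d; field; rewrite gt_eqF.
pose N := Num.truncn (2 * h)^-1.
have iv0 : 0 <= (2 * h)^-1 by rewrite invr_ge0 mulr_ge0// ltW.
have Nh : N%:R * h <= 1 / 2.
  have : N%:R * h <= (2 * h)^-1 * h by rewrite ler_pM2r// truncn_le.
  move=> /le_trans; apply.
  by rewrite le_eqVlt; apply/orP; left; apply/eqP; field; rewrite gt_eqF.
have Nh' : 1 / 4 <= N%:R * h.
  have e2 : (2 * h)^-1 * h = 1 / 2 by field; rewrite gt_eqF.
  have : (2 * h)^-1 * h <= N.+1%:R * h by rewrite ler_pM2r// ltW// truncnS_gt.
  by rewrite e2 -[N.+1%:R]natr1 mulrDl mul1r; lra.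
pose cen (m : nat) i := (1 / 4 + m%:R * h) * w ord0 i.
pose A m i := cen m i - d / 2.
exists d, N, A; split => //.
- have -> : d ^+ n = d * d ^+ n.-1 by rewrite -exprS prednK.
  rewrite mulrA; have -> : N%:R * d = N%:R * h / n%:R by rewrite /h; field; rewrite gt_eqF.
  have -> : capc * th ^+ n.-1 = (4 * n%:R)^-1 * d ^+ n.-1.
    by rewrite /d expr_div_n /capc [in LHS]invfM; ring.
  rewrite ler_wpM2r//; first by rewrite exprn_ge0// ltW.
  by rewrite invfM ler_pM2r ?invr_gt0//; lra.
- move=> m y mN Qy.
  pose s := 1 / 4 + m%:R * h.
  have s1 : 1 / 4 <= s by rewrite lerDl mulr_ge0// ltW.
  have s2 : s <= 3 / 4.
    have : m%:R * h <= N%:R * h by rewrite ler_pM2r// ler_nat ltnW.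
    by rewrite /s; lra.
  have v1 : enorm (y - s *: w) <= h.
    apply: enorm_le_coord => [|i]; first exact: ltW.
    have /forallP/(_ i) := Qy; rewrite !mxE /A /cen -/s => /andP[y1 y2].
    by rewrite ler_norml; apply/andP; split; lra.
  have sw : enorm (s *: w) = s by rewrite enormZ w1 mulr1 ger0_norm//; lra.
  have y_le : enorm y <= s + h.
    by have := ler_enormB y (s *: w); rewrite sw; lra.
  have y_ge : s - h <= enorm y.
    by have := ler_enormB (s *: w) y; rewrite sw enormBC; lra.
  have y0 : y != 0 by apply: contraTneq y_ge => ->; rewrite enorm0 -ltNge; lra.
  have sw0 : s *: w != 0.
    by apply/eqP => e0; move: sw; rewrite e0 enorm0; lra.
  split; [lra|lra|].
  have := normalizeB y0 sw0.
  rewrite sw scalerA mulVf ?scale1r; last by rewrite gt_eqF//; lra.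
  move=> /le_trans; apply.
  apply: (@le_trans _ _ (2 / (1 / 8) * h)); last lra.
  apply: ler_pM => //; rewrite ?enorm_ge0 ?divr_ge0 ?enorm_ge0//.
  by rewrite ler_pM2l// lef_pV2 ?posrE; lra.
- have [i wi] : exists i, 1 <= n%:R * `|w ord0 i|.
    apply/existsP; rewrite -[X in is_true X]negbK negb_exists; apply/negP => /forallP wlt.
    have : enorm w ^+ 2 < 1.
      rewrite enorm_sqr; apply: (@lt_le_trans _ _ (\sum_(i < n) (n%:R^-1 : R))).
        apply: ltr_sum => [|i _]; first by apply/hasP; exists (Ordinal n0); rewrite ?mem_index_enum.
        have := wlt i; rewrite -ltNge => wl.
        have wl' : `|w ord0 i| < n%:R^-1 by rewrite -(ltr_pM2l nR) mulfV ?gt_eqF.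
        rewrite -real_normK ?num_real// expr2.
        apply: le_lt_trans (_ : n%:R^-1 * `|w ord0 i| < _).
          by rewrite ler_wpM2r// ltW.
        by rewrite -[ltRHS]mulr1 ltr_pM2l ?invr_gt0// (lt_le_trans wl')// invf_le1.
      by rewrite sumr_const card_ord -[leLHS]mulr_natl mulfV ?gt_eqF.
    by rewrite w1 expr1n ltxx.
  move=> m m' y /forallP/(_ i)/andP[p1 p2] /forallP/(_ i)/andP[p3 p4].
  have : `|(m%:R - m'%:R) * h * w ord0 i| < d.
    by move: p1 p2 p3 p4; rewrite /A /cen ltr_norml => *; apply/andP; split; lra.
  rewrite normrM (normrM _ h) (gtr0_norm h0) -mulrA (_ : h * _ = d * (n%:R * `|w ord0 i|)); last by rewrite /h; ring.
  move=> lt1.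
  have : `|m%:R - m'%:R| * d < d :> R.
    by apply: le_lt_trans lt1; rewrite ler_wpM2l// ler_peMr// ltW.
  by rewrite -[ltRHS]mul1r ltr_pM2r//; exact: natr_dist_lt1.
Qed.

Lemma ler_cap_intRn (F : 'rV[R]_n -> R) (w : 'rV[R]_n) (th c : R) :
  bdsupp F -> enorm w = 1 -> 0 < th <= 1 -> 0 <= c ->
  (forall y, capcone w th y -> c <= F y) ->
  capc * th ^+ n.-1 * c <= intRn F.
Proof.
move=> bF w1 th01 c0 H.
have F0 z : 0 <= F z by have [? [? [_ /(_ z)/andP[]]]] := bF.
have [d [N [A [d0 Nd inA dis]]]] := cap_cubes w1 th01.
apply: (@le_trans _ _ (\sum_(m < N)
    intRn (fun z => if inbox (A m) (fun i => A m i + d) z then c else 0))).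
  rewrite (eq_bigr (fun=> c * d ^+ n)) => [|m _].
    by rewrite sumr_const card_ord -[leRHS]mulr_natl mulrCA mulrC ler_wpM2l.
  rewrite intRn_box => [|i]; last by rewrite lerDl ltW.
  congr (_ * _); rewrite (eq_bigr (fun=> d)) ?prodr_const ?card_ord// => i _.
  by rewrite addrC addKr.
apply: ler_sum_intRn => // [m z|y]; first by case: ifP.
have [[m ym]|no] := pselect (exists m : 'I_N, cube (A m) d y).
  rewrite (bigD1 m)//= ifT// big1 ?addr0 => [|m' m'm].
    by apply: H; apply: inA ym.
  case: ifP => // ym'.
  by rewrite (val_inj (dis _ _ _ ym' ym)) eqxx in m'm.
by rewrite big1// => m _; case: ifP => // h'; case: no; exists m.
Qed.

Lemma ler_cap_slices_intRn (F : 'rV[R]_n.+1 -> R) (w : 'rV[R]_n) (th : R) (D : nat)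
    (E : 'I_D -> R -> 'rV[R]_n -> bool) (c l eta : 'I_D -> R) :
  bdsupp F -> enorm w = 1 -> 0 < th <= 1 ->
  (forall i, [/\ 0 <= c i, 0 <= l i & 0 < eta i]) ->
  (forall i j t y, E i t y -> E j t y -> i = j) ->
  (forall i y, capcone w th y -> exists al, forall t y', al <= t < al + l i ->
    capcone w th y' -> (forall k, `|y' ord0 k - y ord0 k| <= eta i) ->
    E i t y' /\ c i <= F (pairup t y')) ->
  capc * th ^+ n.-1 * (\sum_i c i * l i) <= intRn F.
Proof.
move=> bF w1 th01 cle dE H.
have F0 z : 0 <= F z by have [? [? [_ /(_ z)/andP[]]]] := bF.
have [d [N [A [d0 Nd inA dis]]]] := cap_cubes w1 th01.
pose tm (z : 'rV[R]_n.+1) := (z : 'rV_(1 + n)) ord0 ord0.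
pose sp (z : 'rV[R]_n.+1) : 'rV[R]_n := rsubmx (z : 'rV_(1 + n)).
have tmE t y : tm (pairup t y) = t.
  rewrite /tm /pairup (_ : ord0 = lshift n (ord0 : 'I_1)); last exact: val_inj.
  by rewrite row_mxEl mxE.
have spE t y : sp (pairup t y) = y by rewrite /sp /pairup row_mxKr.
pose G (k : 'I_D * 'I_N) z :=
  if E k.1 (tm z) (sp z) && cube (A k.2) d (sp z) then F z else 0.
apply: (@le_trans _ _ (\sum_(k : 'I_D * 'I_N) intRn (G k))).
  rewrite -(pair_bigA _ (fun i m => intRn (G (i, m))))/= mulr_sumr.
  apply: ler_sum => i _; have [ci0 li0 ei0] := cle i.
  apply: (@le_trans _ _ (\sum_(m < N) c i * l i * d ^+ n)).
    by rewrite sumr_const card_ord -[leRHS]mulr_natl [leRHS]mulrCA [leLHS]mulrC ler_wpM2l// mulr_ge0.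
  apply: ler_sum => m _; apply: (@grid_le_intRn _ _ _ (A m) d (l i) (c i) (eta i)) => //.
    by apply: bdsupp_le bF _ => z; rewrite /G; case: ifP; rewrite ?F0 ?lexx.
  move=> y ym; have [al Hal] := H i y (inA _ _ (ltn_ord m) ym).
  exists al => t y' tal y'm y'y.
  have [Ey' cF] := Hal t y' tal (inA _ _ (ltn_ord m) y'm) y'y.
  by rewrite /G tmE spE /= Ey' y'm.
apply: ler_sum_intRn => // [k z|z]; first by rewrite /G; case: ifP.
have [[k ik]|no] := pselect (exists k : 'I_D * 'I_N,
    E k.1 (tm z) (sp z) && cube (A k.2) d (sp z)).
  rewrite (bigD1 k)//= {1}/G ik big1 ?addr0 => // k' k'k.
  rewrite /G; case: ifP => // /andP[E1 Q1]; case/andP: ik => E2 Q2.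
  move: k'k; rewrite [k']surjective_pairing [k]surjective_pairing.
  by rewrite (dE _ _ _ _ E1 E2) (val_inj (dis _ _ _ Q1 Q2)) eqxx.
by rewrite big1// => k _; rewrite /G; case: ifP => // h'; case: no; exists k.
Qed.

End Cap.

(** * Lower bounds for the retarded potential *)

Section Homogeneity.
Import HBNNSimple.

Lemma ge0_integralZ_le d (T : measurableType d) (R : realType)
    (mu : {measure set T -> \bar R}) (f : T -> R) (c : R) :
  (forall x, 0 <= f x) -> 0 < c ->
  (\int[mu]_x (c * f x)%:E <= c%:E * \int[mu]_x (f x)%:E)%E.
Proof.
move=> f0 c0; have ci0 : 0 <= c^-1 by rewrite invr_ge0 ltW.
rewrite -lee_pdivrMl// ge0_integralTE; last first.
  by move=> x; rewrite lee_fin mulr_ge0// ltW.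
rewrite lee_pdivrMl//; apply: ge_ereal_sup => _ [h /= hf <-].
rewrite -lee_pdivrMl// -sintegralrM ge0_integralTE; last by move=> x; rewrite lee_fin.
apply: ereal_sup_ubound; exists (scale_nnsfun h ci0) => // x /=.
by rewrite lee_fin ler_pdivrMl// -lee_fin.
Qed.

End Homogeneity.

Section Retarded.
Variables (R : realType).
Local Notation mu := (@lebesgue_measure R).

Lemma Rintegral_scale_le (f : R -> R) (c : R) : bdsupp1 f -> 0 <= c ->
  Rintegral mu setT (fun x => c * f x) <= c * Rintegral mu setT f.
Proof.
move=> bf; rewrite le_eqVlt => /predU1P[<-|c0].
  rewrite mul0r (_ : (fun x => _) = fun x : R => if 0 <= x < 0 then 0 else 0).
    by rewrite Rintegral_itv_cst ?mul0r.
  by apply/funext => x; rewrite mul0r; case: ifP.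
have f0 x : 0 <= f x by have [? [? [_ /(_ x)/andP[]]]] := bf.
have fin := bdsupp1_fin bf.
rewrite -[X in X * _]/(fine c%:E) -fineM//; apply: fine_le.
- have [K [L [L0 H]]] := bf; apply: (@bdsupp1_fin _ (fun x => c * f x)).
  exists (c * K), L; split => // x; have /andP[fx0 fK] := H x.
  rewrite mulr_ge0//= ?(ltW c0)//; move: fK; case: ifP => _ fK.
    by rewrite ler_pM2l.
  by rewrite pmulr_rle0.
- exact: fin_numM.
- exact: ge0_integralZ_le.
Qed.

Lemma bdsupp_scale n (F : 'rV[R]_n -> R) c : bdsupp F -> 0 <= c ->
  bdsupp (fun y => c * F y).
Proof.
move=> [K [L [L0 H]]] c0; exists (c * K), L; split => // y.
have /andP[F0 FK] := H y; rewrite mulr_ge0//=.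
move: FK; case: ifP => _ FK; first by rewrite ler_wpM2l.
by rewrite (le_trans (ler_wpM2l c0 FK)) ?mulr0.
Qed.

Lemma intRn_scale_le n (F : 'rV[R]_n -> R) c : bdsupp F -> 0 <= c ->
  intRn (fun y => c * F y) <= c * intRn F.
Proof.
elim: n F => [//|n IH F bF c0].
have bI := bdsupp_intRn_slice bF.
apply: le_trans (Rintegral_scale_le bI c0).
have I0 t : 0 <= intRn (fun y : 'rV[R]_n => F (row_mx (const_mx t : 'rV_1) y)).
  by have [? [? [_ /(_ t)/andP[]]]] := bI.
have F0 z : 0 <= F z by have [? [? [_ /(_ z)/andP[]]]] := bF.
apply: Rintegral_le => [|t].
  have [K [L [L0 H]]] := bI; exists (c * K), L; split => // t.
  have /andP[_ IK] := H t; rewrite mulr_ge0//=.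
  move: IK; case: ifP => _ IK; first by rewrite ler_wpM2l.
  by rewrite (le_trans (ler_wpM2l c0 IK)) ?mulr0.
rewrite IH//; last exact: bdsupp_slice.
by rewrite andbT intRn_ge0// => y; rewrite mulr_ge0.
Qed.

Variable n : nat.
Hypothesis n0 : (0 < n)%N.
Implicit Types (x y w : 'rV[R]_n) (G : 'rV[R]_n -> R -> R).

Lemma bdsupp_unit_ball (h : 'rV[R]_n -> R) B :
  (forall y, enorm y <= 1 -> 0 <= h y <= B) ->
  bdsupp (fun y => if enorm y <= 1 then h y else 0).
Proof.
move=> H; exists `|B|, 2; split => // y.
case: ifP => [y1|_]; last by case: ifP; rewrite lexx/=.
have /andP[-> hB] := H y y1; rewrite ifT ?(le_trans hB) ?ler_norm//.
apply/forallP => i; have := le_trans (le_coord_enorm y i) y1.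
by rewrite ler_norml => /andP[? ?]; apply/andP; split; lra.
Qed.

Definition retarded G x (t : R) : R :=
  Rintegral mu `[0, t]%classic
    (fun tau => (t - tau) * sphint (fun w => G (x + (t - tau) *: w) tau)).

Lemma enorm_unit_le1 y : enorm ((enorm y)^-1 *: y) <= 1.
Proof.
have [->|y0] := eqVneq y 0; first by rewrite scaler0 enorm0.
by rewrite enorm_normalize.
Qed.

Definition bounded_in_past G x (t : R) := exists B, forall tau y,
  0 <= tau <= t -> enorm y <= enorm x + t -> 0 <= G y tau <= B.

Definition retarded_integrand G x (t : R) (z : 'rV[R]_n.+1) : R :=
  let tau := (z : 'rV_(1 + n)) ord0 ord0 in let y := rsubmx (z : 'rV_(1 + n)) in
  if (0 <= tau <= t) && (enorm y <= 1) then
    (t - tau) * (n%:R * G (x + (t - tau) *: ((enorm y)^-1 *: y)) tau)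
  else 0.

Lemma retarded_integrandE G x t tau y :
  retarded_integrand G x t (pairup tau y) =
  if (0 <= tau <= t) && (enorm y <= 1) then
    (t - tau) * (n%:R * G (x + (t - tau) *: ((enorm y)^-1 *: y)) tau)
  else 0.
Proof.
rewrite /retarded_integrand /pairup row_mxKr.
have -> : (row_mx (const_mx tau : 'rV[R]_1) y) ord0 ord0 = tau; last by [].
by rewrite (_ : ord0 = lshift n (ord0 : 'I_1)) ?row_mxEl ?mxE//; exact: val_inj.
Qed.

Lemma past_cone x t tau (w : 'rV[R]_n) : 0 <= tau <= t -> enorm w <= 1 ->
  enorm (x + (t - tau) *: w) <= enorm x + t.
Proof.
move=> /andP[tau0 taut] w1; rewrite (le_trans (ler_enormD _ _))// lerD2l enormZ.
rewrite ger0_norm ?subr_ge0//; apply: (@le_trans _ _ ((t - tau) * 1)); last lra.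
by rewrite ler_wpM2l// subr_ge0.
Qed.

Lemma bdsupp_retarded G x t : bounded_in_past G x t ->
  bdsupp (retarded_integrand G x t).
Proof.
move=> [B HB]; exists (`|t| * (n%:R * `|B|)), (`|t| + 2).
split => [|z]; first by have := normr_ge0 t; lra.
have [tau [y ->]] := pairupE z; rewrite retarded_integrandE.
case: ifP => [/andP[/[dup] t01 /andP[tau0 taut] y1]|_]; last first.
  by case: ifP; rewrite lexx ?mulr_ge0.
have /andP[G0 GB] := HB tau _ t01 (past_cone x t01 (enorm_unit_le1 y)).
have tn := ler_norm t.
rewrite !mulr_ge0 ?subr_ge0//= ifT.
  apply: ler_pM; rewrite ?subr_ge0 ?mulr_ge0//; first lra.
  by rewrite ler_wpM2l// (le_trans GB)// ler_norm.
rewrite inbox_row; apply/andP; split; first by apply/andP; split; lra.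
apply/forallP => i; have := le_trans (le_coord_enorm y i) y1.
by rewrite ler_norml => /andP[? ?]; apply/andP; split; lra.
Qed.

Lemma intRn_le_retarded G x t : bounded_in_past G x t ->
  intRn (retarded_integrand G x t) <= retarded G x t.
Proof.
move=> bG; have bF := bdsupp_retarded bG; have [B HB] := bG.
rewrite /retarded Rintegral_mkcond /=.
pose g tau y := if enorm y <= 1 then
  G (x + (t - tau) *: ((enorm y)^-1 *: y)) tau else 0.
have bg tau : 0 <= tau <= t -> bdsupp (g tau).
  move=> t01; apply: (@bdsupp_unit_ball _ B) => y y1.
  exact: HB (past_cone x t01 (enorm_unit_le1 y)).
have g0 tau y : 0 <= tau <= t -> 0 <= g tau y.
  by move=> t01; have [? [? [_ /(_ y)/andP[]]]] := bg _ t01.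
apply: Rintegral_le => [|tau]; last first.
  rewrite patchE mem_setE in_itv/=; case: ifP => t01; last first.
    rewrite [X in intRn X](_ : _ = fun=> 0) ?intRn_cst0 ?lexx//.
    by apply/funext => y; rewrite -/(pairup tau y) retarded_integrandE t01.
  have /andP[tau0 taut] := t01.
  rewrite intRn_ge0/= => [|y]; last first.
    by have [? [? [_ /(_ (row_mx (const_mx tau : 'rV_1) y))/andP[]]]] := bF.
  rewrite /sphint mulrA.
  have c0 : 0 <= (t - tau) * n%:R by rewrite mulr_ge0// subr_ge0.
  apply: le_trans (intRn_scale_le (bg _ t01) c0).
  apply: intRn_le => [|y]; first exact: bdsupp_scale (bg _ t01) c0.
  rewrite -/(pairup tau y) retarded_integrandE t01/= /g.
  case: ifP => y1; last by rewrite mulr0 lexx.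
  rewrite -mulrA lexx andbT !mulr_ge0 ?subr_ge0//.
  by have := g0 tau y t01; rewrite /g y1.
exists (`|t| * (n%:R * (`|B| * \prod_(i < n) (2 - - 2)))), (`|t| + 1).
split => [|tau]; first by have := normr_ge0 t; lra.
rewrite patchE mem_setE in_itv/=; case: ifP => t01; last first.
  rewrite lexx/=; case: ifP => _ //; apply: mulr_ge0 => //; apply: mulr_ge0 => //.
  by apply: mulr_ge0 => //; apply: prodr_ge0 => i _; lra.
have /andP[tau0 taut] := t01; have tn := ler_norm t.
have S0 : 0 <= intRn (g tau) by apply: intRn_ge0 => y; exact: g0.
rewrite ifT; last by apply/andP; split; lra.
rewrite /sphint -/(g tau) !mulr_ge0 ?subr_ge0//=.
apply: ler_pM; rewrite ?subr_ge0 ?mulr_ge0//; first lra.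
rewrite ler_wpM2l// -intRn_box; last by move=> ?; lra.
apply: intRn_le => [|y]; first by exists `|B|, 2; split => // y; case: ifP; rewrite ?lexx ?normr_ge0.
rewrite g0//= /g; case: ifP => [y1|_]; last by case: ifP.
rewrite ifT ?(le_trans _ (ler_norm B))//.
  by have /andP[] := HB tau _ t01 (past_cone x t01 (enorm_unit_le1 y)).
apply/forallP => i; have := le_trans (le_coord_enorm y i) y1.
by rewrite ler_norml => /andP[? ?]; apply/andP; split; lra.
Qed.

Lemma retarded_ge0 G x t : bounded_in_past G x t -> 0 <= retarded G x t.
Proof.
move=> bG; apply: le_trans (intRn_le_retarded bG); apply: intRn_ge0 => z.
by have [? [? [_ /(_ z)/andP[]]]] := bdsupp_retarded bG.
Qed.

Lemma retarded_ge_cst G x t t1 t2 K w : enorm w = 1 -> bounded_in_past G x t ->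
  0 <= t1 -> t1 <= t2 -> t2 <= t -> 0 <= K ->
  (forall y tau, t1 <= tau <= t2 -> enorm (y - x) = t - tau -> K <= G y tau) ->
  capc R n * (n%:R * (t - t2) * (t2 - t1) * K) <= retarded G x t.
Proof.
move=> w1 bG t10 t12 t2t K0 H; apply: le_trans (intRn_le_retarded bG).
have := @ler_cap_slices_intRn _ _ n0 _ w 1 1 (fun _ _ _ => true)
  (fun=> n%:R * (t - t2) * K) (fun=> t2 - t1) (fun=> 1) (bdsupp_retarded bG) w1.
rewrite big_ord1 expr1n mulr1; move=> h; apply: le_trans (h _ _ _ _).
- by rewrite le_eqVlt; apply/orP; left; apply/eqP; ring.
- by rewrite ltr01 lexx.
- by move=> i; split; rewrite // ?mulr_ge0 ?subr_ge0.
- by move=> i j *; rewrite !ord1.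
move=> _ y [y8 y1 _]; exists t1 => tau y' /andP[tau1 tau2] [y'8 y'1 _] _; split => //.
have tau2' : tau < t2 by lra.
have t01 : 0 <= tau <= t by apply/andP; split; lra.
rewrite retarded_integrandE t01 y'1/= -mulrA mulrCA.
have y'0 : y' != 0 by apply: contraTneq y'8 => ->; rewrite enorm0 -ltNge; lra.
apply: ler_pM; rewrite ?mulr_ge0 ?subr_ge0//; first lra.
rewrite ler_wpM2l//; apply: H; first by apply/andP; split; lra.
by rewrite addrC addKr enormZ enorm_normalize// mulr1 ger0_norm// subr_ge0; lra.
Qed.

End Retarded.

Section Slices.
Variables (R : realType) (n : nat).
Hypothesis n0 : (0 < n)%N.
Implicit Types (x y w : 'rV[R]_n) (G : 'rV[R]_n -> R -> R).

Definition ray_phase x (t : R) w (tau : R) := tau - enorm (x + (t - tau) *: w).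

Lemma ray_phase_lip x t w s1 s2 : enorm w = 1 -> s1 <= s2 ->
  0 <= ray_phase x t w s2 - ray_phase x t w s1 <= 2 * (s2 - s1).
Proof.
move=> w1 s12.
have e : (x + (t - s1) *: w) - (x + (t - s2) *: w) = (s2 - s1) *: w.
  by rewrite opprD addrACA subrr add0r -scalerBl; congr (_ *: _); ring.
have l1 := ler_enormB (x + (t - s1) *: w) (x + (t - s2) *: w).
have l2 := ler_enormB (x + (t - s2) *: w) (x + (t - s1) *: w).
rewrite enormBC in l2; rewrite e enormZ w1 mulr1 ger0_norm ?subr_ge0// in l1 l2.
by rewrite /ray_phase; apply/andP; split; lra.
Qed.

Lemma ray_phase_dir x t w w' s : s <= t ->
  `|ray_phase x t w' s - ray_phase x t w s| <= (t - s) * enorm (w' - w).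
Proof.
move=> st.
have e : (x + (t - s) *: w) - (x + (t - s) *: w') = (t - s) *: (w - w').
  by rewrite opprD addrACA subrr add0r scalerBr.
have l1 := ler_enormB (x + (t - s) *: w) (x + (t - s) *: w').
have l2 := ler_enormB (x + (t - s) *: w') (x + (t - s) *: w).
rewrite enormBC in l2; rewrite e enormZ enormBC ger0_norm ?subr_ge0// in l1 l2.
by rewrite /ray_phase ler_norml; apply/andP; split; lra.
Qed.

Lemma continuous_ray_phase x t w : enorm w = 1 -> continuous (ray_phase x t w).
Proof.
move=> w1 s; apply/cvgrPdist_lt => e e0; near=> s'.
apply: (@le_lt_trans _ _ (2 * `|s - s'|)).
  have [ss'|/ltW ss'] := leP s s'.
    have /andP[h1 h2] := @ray_phase_lip x t w s s' w1 ss'.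
    by rewrite distrC (distrC s) !ger0_norm ?subr_ge0// -subr_ge0.
  have /andP[h1 h2] := @ray_phase_lip x t w s' s w1 ss'.
  by rewrite !ger0_norm ?subr_ge0// -subr_ge0.
rewrite -ltr_pdivlMl// mulrC; near: s'.
by apply: (@cvgr_dist_lt _ _ _ _ _ id s); rewrite ?divr_gt0//; exact: cvg_id.
Unshelve. all: by end_near. Qed.

Lemma retarded_ge_slices G x t w th ts wgt D (b K : nat -> R) :
  enorm w = 1 -> 0 < th <= 1 -> bounded_in_past G x t ->
  0 <= ts -> ts <= t -> 0 <= wgt -> wgt <= t - ts ->
  0 <= b 0%N -> (forall i, b i < b i.+1) -> (forall i, 0 <= K i) ->
  (forall w', enorm w' = 1 -> enorm (w' - w) <= th -> b D <= ray_phase x t w' ts) ->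
  (forall w' tau i, enorm w' = 1 -> enorm (w' - w) <= th -> (i < D)%N ->
     0 <= tau <= ts -> b i <= ray_phase x t w' tau <= b i.+1 ->
     K i <= G (x + (t - tau) *: w') tau) ->
  capc R n * th ^+ n.-1 * (n%:R * wgt / 4) * (\sum_(i < D) K i * (b i.+1 - b i))
    <= retarded G x t.
Proof.
move=> w1 th01 bG ts0 tst wgt0 wgtt b0 bS K0 Hend H.
apply: le_trans (intRn_le_retarded bG).
have bm i j : (i <= j)%N -> b i <= b j.
  by apply: (@homo_leq _ b (fun u v => u <= v)) => // [u v w' |i']; [exact: le_trans|exact: ltW].
have bi0 i : 0 <= b i by exact: le_trans (bm 0%N i _).
have nR : 0 < n%:R :> R by rewrite ltr0n.
have t0 : 0 <= t by exact: le_trans tst.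
pose E (i : 'I_D) tau y := b i <= ray_phase x t ((enorm y)^-1 *: y) tau < b i.+1.
pose eta (i : 'I_D) := (b i.+1 - b i) / (64 * (n%:R * (t + 1))).
have eta0 i : 0 < eta i by rewrite divr_gt0 ?subr_gt0// !mulr_gt0//; lra.
have := @ler_cap_slices_intRn _ _ n0 _ w th D E
  (fun i => n%:R * wgt * K i) (fun i => (b i.+1 - b i) / 4) eta
  (bdsupp_retarded bG) w1 th01.
move=> h; apply: le_trans (h _ _ _).
- rewrite -!mulrA !mulr_sumr; apply: ler_sum => i _.
  by rewrite le_eqVlt; apply/orP; left; apply/eqP; field.
- by move=> i; split; rewrite // ?mulr_ge0 ?subr_ge0 ?(ltW (bS _))// ltW.
- move=> i j tau y /andP[e1 e2] /andP[e3 e4]; apply/val_inj/eqP.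
  rewrite eqn_leq; apply/andP; split; rewrite leqNgt; apply/negP => /bm.
    by move=> bji; lra.
  by move=> bji; lra.
move=> i y [y8 y1 yth].
have y0 : y != 0 by apply: contraTneq y8 => ->; rewrite enorm0 -ltNge; lra.
set w' := (enorm y)^-1 *: y in yth.
have w'1 : enorm w' = 1 by exact: enorm_normalize.
set d := b i.+1 - b i; have d0 : 0 < d by rewrite subr_gt0.
have bD := Hend w' w'1 yth.
have biD : b i.+1 <= b D by exact: bm.
have [al /[!in_itv]/andP[al0 alts] phal] :
    exists2 al, al \in `[0, ts] & ray_phase x t w' al = b i + d / 4.
  apply: IVT => //.
    by apply: continuous_subspaceT => s; exact: continuous_ray_phase.
  have ph0 : ray_phase x t w' 0 <= 0 by rewrite /ray_phase sub0r oppr_le0 enorm_ge0.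
  have := bi0 i; rewrite ge_min le_max => ?; apply/andP; split.
    by apply/orP; left; lra.
  by apply/orP; right; rewrite /d; rewrite /d in d0; lra.
exists al => tau y' /andP[tau1 tau2] [y'8 y'1 y'th] y'y.
have y'0 : y' != 0 by apply: contraTneq y'8 => ->; rewrite enorm0 -ltNge; lra.
set w'' := (enorm y')^-1 *: y' in y'th *.
have w''1 : enorm w'' = 1 by exact: enorm_normalize.
have /andP[p1 p2] := @ray_phase_lip x t w' al tau w'1 tau1.
have taults : tau < ts.
  rewrite ltNge; apply/negP => tstau.
  have /andP[q1 q2] := @ray_phase_lip x t w' ts tau w'1 tstau.
  by rewrite -/d in tau2; rewrite /d in d0 phal tau2; lra.
have tau0 : 0 <= tau by exact: le_trans tau1.
have dist : enorm (w'' - w') <= 16 * (n%:R * eta i).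
  apply: le_trans (normalizeB y'0 y0) _; apply: ler_pM.
  - by rewrite divr_ge0 ?enorm_ge0.
  - exact: enorm_ge0.
  - rewrite (_ : 16 = 2 / (1 / 8)); last by field.
    by rewrite ler_pM2l// lef_pV2 ?posrE; lra.
  - by apply: enorm_le_coord => [|k]; [exact: ltW|have := y'y k; rewrite !mxE].
have dir : `|ray_phase x t w'' tau - ray_phase x t w' tau| < d / 4 + 0.
  have tt : tau <= t by lra.
  apply: le_lt_trans (ray_phase_dir x w' w'' tt) _.
  apply: (@le_lt_trans _ _ (t * (16 * (n%:R * eta i)))).
    by apply: ler_pM; rewrite ?subr_ge0 ?enorm_ge0//; lra.
  rewrite addr0 /eta -/d.
  rewrite [ltLHS](_ : _ = d / 4 * (t / (t + 1))); last first.
    by field; apply/andP; split; rewrite gt_eqF//; lra.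
  rewrite -[ltRHS]mulr1 ltr_pM2l ?divr_gt0// ltr_pdivrMr; lra.
move: dir; rewrite addr0 ltr_norml => /andP[r1 r2].
have Ein : E i tau y'.
  rewrite /E -/w''; rewrite -/d in tau2.
  by rewrite /d in d0 phal tau2 r1 r2; apply/andP; split; lra.
split; first exact: Ein.
rewrite retarded_integrandE y'1 andbT ifT; last by apply/andP; split; lra.
rewrite -mulrA mulrCA; apply: ler_pM; rewrite ?mulr_ge0 ?subr_ge0//; first lra.
rewrite ler_wpM2l//; apply: H => //; first by apply/andP; split; lra.
by case/andP: Ein => -> /ltW.
Qed.

End Slices.

(** * Interior, near-cone and blow-up estimates *)

Section Supersolution.
Variables (R : realType) (n : nat).
Hypothesis n0 : (0 < n)%N.
Variables (p kap cN T : R) (u : 'rV[R]_n -> R -> R).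
Hypotheses (p1 : 1 < p) (cN0 : 0 < cN).
Let G y tau := `|u y tau| `^ p.
Hypothesis bG : forall (x : 'rV[R]_n) (t : R), 0 <= t <= T -> bounded_in_past G x t.
Hypothesis uN : forall (x : 'rV[R]_n) (t : R), 0 <= t <= T -> kap < t - enorm x ->
  cN * retarded G x t <= u x t.

Let nR : 0 < n%:R :> R. Proof. by rewrite ltr0n. Qed.
Let p0 : 0 <= p. Proof. by apply: ltW; apply: lt_trans p1. Qed.

Lemma le_powR_norm K v : 0 <= K -> K <= v -> K `^ p <= `|v| `^ p.
Proof.
move=> K0 Kv; apply: ge0_ler_powR; rewrite ?nnegrE//.
by rewrite (le_trans Kv)// ler_norm.
Qed.

Definition interior_const := cN * (capc R n * (n%:R * (3 / 16) / 4)).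

Lemma interior_const_gt0 : 0 < interior_const.
Proof. by rewrite !mulr_gt0// capc_gt0. Qed.

Lemma interior_lower_bound (w : 'rV[R]_n) (L b1 b2 K : R) : enorm w = 1 ->
  0 < L <= T -> kap < L / 2 -> 0 <= b1 < b2 -> b2 <= L / 16 -> 0 <= K ->
  (forall y tau, 0 <= tau <= L -> b1 <= tau - enorm y <= b2 -> L / 8 <= enorm y ->
     K <= u y tau) ->
  forall x t, 3 / 4 * L <= t <= L -> enorm x <= L - t ->
  interior_const * (K `^ p * (b2 - b1) * L) <= u x t.
Proof.
move=> w1 /andP[L0 LT] kL /andP[b10 b12] b2L K0 H x t /andP[t1 t2] xL.
have t0T : 0 <= t <= T by apply/andP; split; lra.
apply: le_trans (uN t0T _); last lra.
rewrite /interior_const -mulrA ler_pM2l//.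
have := @retarded_ge_slices R n n0 G x t w 1 (3 / 4 * t) (3 / 16 * L) 1
  (fun i => b1 + i%:R * (b2 - b1)) (fun=> K `^ p) w1.
rewrite big_ord1 expr1n mulr1; move=> h; apply: le_trans (h _ _ _ _ _ _ _ _ _ _ _); rewrite {h}.
- by rewrite le_eqVlt; apply/orP; left; apply/eqP; field.
- by rewrite ltr01 lexx.
- exact: bG.
- lra.
- lra.
- lra.
- lra.
- by rewrite mul0r addr0.
- by move=> i; rewrite -natr1; lra.
- by move=> _; exact: powR_ge0.
- move=> w' w'1 _; rewrite mul1r addrC subrK /ray_phase.
  have := ler_enormD x ((t - 3 / 4 * t) *: w').
  by rewrite enormZ w'1 mulr1 ger0_norm; lra.
- move=> w' tau i w'1 _; rewrite ltnS leqn0 => /eqP-> /andP[tau0 taut].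
  rewrite mul0r addr0 mul1r (addrC b1) subrK /ray_phase => /andP[ph1 ph2].
  apply: le_powR_norm => //; apply: H; [by apply/andP; split; lra|by rewrite ph1 ph2|].
  have := ler_enormB ((t - tau) *: w') (- x).
  rewrite opprK enormN (addrC _ x) enormZ w'1 mulr1 ger0_norm; last lra.
  lra.
Qed.

Definition cone_const := cN * (capc R n * (1 / 8) ^+ n.-1 * (n%:R / 4)).

Lemma cone_const_gt0 : 0 < cone_const.
Proof. by rewrite !mulr_gt0 ?exprn_gt0 ?capc_gt0. Qed.

Lemma cone_lower_bound (x : 'rV[R]_n) (t s : R) D (b K : nat -> R) :
  s = t - enorm x -> 0 <= t <= T -> kap < s -> 0 < s -> s <= enorm x ->
  0 <= b 0%N -> (forall i, b i < b i.+1) -> b D <= s / 2 -> (forall i, 0 <= K i) ->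
  (forall y tau i, (i < D)%N -> 0 <= tau <= t -> b i <= tau - enorm y <= b i.+1 ->
     s / 4 <= enorm y <= 2 * s -> K i <= u y tau) ->
  cone_const * ((s / enorm x) ^+ n.-1 * enorm x *
    (\sum_(i < D) K i `^ p * (b i.+1 - b i))) <= u x t.
Proof.
move=> se tT ks s0 sx b0 bS bD K0 H.
have bm i j : (i <= j)%N -> b i <= b j.
  by apply: (@homo_leq _ b (fun u v => u <= v)) => // [u' v w'|i']; [exact: le_trans|exact: ltW].
apply: le_trans (uN tT _); last by rewrite -se.
rewrite /cone_const -mulrA ler_pM2l//.
set r := enorm x in se sx *.
have r0 : 0 < r by lra.
pose w := - (r^-1 *: x).
have w1 : enorm w = 1.
  by rewrite enormN enormZ ger0_norm ?invr_ge0 ?(ltW r0)// mulVf// gt_eqF.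
have xw : x = (- r) *: w by rewrite scaleNr scalerN opprK scalerA mulfV ?scale1r// gt_eqF.
have dev w' rho : 0 <= rho -> enorm (w' - w) <= s / (8 * r) ->
    enorm (x + rho *: w') <= `|rho - r| + rho * (s / (8 * r)).
  move=> rho0 ww; have -> : x + rho *: w' = (rho - r) *: w + rho *: (w' - w).
    by rewrite {1}xw scalerBr scalerBl -scaleNr [RHS]addrC addrA subrK addrC.
  rewrite (le_trans (ler_enormD _ _))// !enormZ w1 mulr1 (ger0_norm rho0) lerD2l.
  by rewrite ler_wpM2l.
have := @retarded_ge_slices R n n0 G x t w (s / (8 * r)) s r D b
  (fun i => K i `^ p) w1.
move=> h; apply: le_trans (h _ _ _ _ _ _ _ _ _ _ _); rewrite {h}.
- have -> : s / (8 * r) = 1 / 8 * (s / r) by field; rewrite gt_eqF.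
  rewrite (exprMn _ (1 / 8)); move: (_ ^+ n.-1) ((s / r) ^+ n.-1) (\sum_(i < D) _) => X Y Z.
  by rewrite le_eqVlt; apply/orP; left; apply/eqP; field.
- apply/andP; split; first by rewrite divr_gt0// mulr_gt0.
  by rewrite ler_pdivrMr ?mulr_gt0//; lra.
- exact: bG.
- lra.
- lra.
- lra.
- lra.
- by [].
- by [].
- by move=> i; exact: powR_ge0.
- move=> w' w'1 ww'; rewrite /ray_phase.
  have := dev w' (t - s) _ ww'; rewrite (_ : t - s = r); last lra.
  rewrite subrr normr0 add0r (_ : r * _ = s / 8); last by field; rewrite gt_eqF.
  by move=> /(_ (ltW r0)); lra.
- move=> w' tau i w'1 ww' iD /andP[tau0 taus]; rewrite /ray_phase => /andP[ph1 ph2].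
  apply: le_powR_norm; first exact: K0.
  apply: (H _ _ _ iD); [by apply/andP; split; lra|by rewrite ph1 ph2|].
  have := bm i.+1 D iD => biD.
  have t0 : 0 <= t - tau by lra.
  have := dev w' (t - tau) t0 ww'.
  rewrite ger0_norm; last lra.
  have e2 : (t - tau) * (s / (8 * r)) <= s / 4.
    rewrite mulrA ler_pdivrMr ?mulr_gt0//.
    rewrite (_ : s / 4 * (8 * r) = (2 * r) * s); last by field.
    by rewrite ler_pM2r//; lra.
  have := ler_enormB ((t - tau) *: w') (- x).
  rewrite opprK enormN (addrC _ x) enormZ w'1 mulr1 ger0_norm//= -/r => l1 l2.
  by apply/andP; split; lra.
Qed.

Definition blowup_ratio := Num.sqrt (2 / 2 `^ p).

Lemma blowup_ratio_bounds : 0 < blowup_ratio < 1.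
Proof.
have A0 : 0 < 2 `^ p :> R by exact: powR_gt0.
rewrite sqrtr_gt0 divr_gt0//=.
rewrite -sqrtr1 ltr_sqrt// ltr_pdivrMr// mul1r -[ltLHS]powRr1// /powR gt_eqF// ltr_expR ltr_pM2r//.
by rewrite ln_gt0// ltr1n.
Qed.

Definition doubling_const := cN * (capc R n * (n%:R / 4)).

Lemma doubling_const_gt0 : 0 < doubling_const.
Proof. by rewrite !mulr_gt0// capc_gt0. Qed.

Definition blowup_const := 32 / (doubling_const * (1 - blowup_ratio) ^+ 2).

Lemma powR_exp2 (j : nat) : (2 ^+ j) `^ p = (2 `^ p) ^+ j :> R.
Proof.
elim: j => [|j IH]; first by rewrite !expr0 powR1.
by rewrite !exprS powRM ?exprn_ge0// IH.
Qed.

(* On the cone [|x| <= L - t] the inequality reduces to the ODE inequality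
   w'' >= c w^p; the lower bound doubles on times [t_j] with summable gaps. *)
Lemma blowup_in_cone (w : 'rV[R]_n) (L M : R) : enorm w = 1 -> 0 < L <= T -> kap < L / 2 -> 0 < M ->
  blowup_const <= M `^ (p - 1) * L ^+ 2 ->
  ~ (forall x t, 3 / 4 * L <= t <= L -> enorm x <= L - t -> M <= u x t).
Proof.
move=> w1 /andP[L0 LT] kL M0 cond H.
have /andP[th0 th1] := blowup_ratio_bounds; set th := blowup_ratio in th0 th1 cond.
have c0 := doubling_const_gt0; set c := doubling_const in c0 cond.
have A0 : 0 < 2 `^ p :> R by exact: powR_gt0.
have thsq : th ^+ 2 = 2 / 2 `^ p by rewrite sqr_sqrtr// divr_ge0// ltW.
have Mp0 : 0 < M `^ p by exact: powR_gt0.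
pose d := Num.sqrt (2 * M / (c * M `^ p)).
have dsq : c * d ^+ 2 * M `^ p = 2 * M.
  rewrite sqr_sqrtr; last first.
    by apply: ltW; apply: divr_gt0; apply: mulr_gt0.
  by field; rewrite !gt_eqF.
have d0 : 0 < d by rewrite sqrtr_gt0; apply: divr_gt0; apply: mulr_gt0.
have dL : d / (1 - th) <= L / 4.
  rewrite ler_pdivrMr; last lra.
  have r0 : 0 <= L / 4 * (1 - th) by rewrite mulr_ge0; lra.
  rewrite -(@ler_pXn2r _ 2)// ?nnegrE// ?(ltW d0)//.
  have -> : d ^+ 2 = 2 * M / (c * M `^ p).
    by rewrite -dsq; field; rewrite !gt_eqF.
  have MM : M `^ p = M * M `^ (p - 1).
    by rewrite mulr_powRB1 ?(ltW M0)//; apply: lt_trans p1.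
  have M10 : 0 < M `^ (p - 1) by exact: powR_gt0.
  rewrite MM (_ : 2 * M / _ = 2 / (c * M `^ (p - 1))); last by field; rewrite !gt_eqF.
  rewrite ler_pdivrMr; last by rewrite mulr_gt0.
  have pos : 0 < c * (1 - th) ^+ 2 by apply: mulr_gt0 => //; apply: exprn_gt0; lra.
  move: cond; rewrite /blowup_const -/c -/th (ler_pdivrMr _ _ pos) => cond.
  rewrite (_ : _ * (c * _) = (M `^ (p - 1) * L ^+ 2 * (c * (1 - th) ^+ 2)) / 16); last by field.
  lra.
have [tm [tm0 tmS tm_le tm_ge]] : exists tm : nat -> R, [/\ tm 0%N = 3 / 4 * L,
    forall j, tm j.+1 = tm j + d * th ^+ j, forall j, tm j <= L &
    forall j, 3 / 4 * L <= tm j].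
  exists (fun j => 3 / 4 * L + d * (1 - th ^+ j) / (1 - th)); split => [|j|j|j].
  - by rewrite expr0 subrr mulr0 mul0r addr0.
  - by rewrite exprS; field; rewrite subr_eq0 gt_eqF.
  - have : d * (1 - th ^+ j) / (1 - th) <= d / (1 - th).
      rewrite ler_pM2r ?invr_gt0; last lra.
      by rewrite ler_piMr ?(ltW d0)// gerBl exprn_ge0// ltW.
    by move: dL; move: (d * _ / _) (d / _) => X Y; lra.
  - rewrite lerDl divr_ge0//; last lra.
    by rewrite mulr_ge0 ?(ltW d0)// subr_ge0 exprn_ile1// ltW.
have dbl j (x : 'rV[R]_n) (t : R) : tm j <= t <= L -> enorm x <= L - t -> 2 ^+ j * M <= u x t.
  elim: j x t => [x t tj xL|j IH x t /andP[tj1 tj2] xL].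
    rewrite expr0 mul1r; apply: H => //.
    by rewrite -tm0.
  have [e eE] : exists e, e = d * th ^+ j by exists (d * th ^+ j).
  have e0 : 0 < e by rewrite eE; apply: mulr_gt0 => //; exact: exprn_gt0.
  have te := tmS j; have tj0 := tm_ge j; have tjL := tm_le j.
  rewrite -eE in te.
  have t0T : 0 <= t <= T by apply/andP; split; lra.
  apply: le_trans (uN t0T _); last lra.
  have B0 : 0 <= (2 ^+ j * M) `^ p by exact: powR_ge0.
  have := @retarded_ge_cst R n n0 G x t (t - e) (t - e / 2) ((2 ^+ j * M) `^ p) w w1 (bG x t0T).
  move=> h; apply: le_trans (ler_wpM2l (ltW cN0) (h _ _ _ _ _)); rewrite {h}//; try lra.
    rewrite [leRHS](_ : _ = c * (e ^+ 2 * (2 ^+ j * M) `^ p)); last first.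
      by rewrite /c /doubling_const; field.
    rewrite powRM ?exprn_ge0 ?(ltW M0)// powR_exp2 eE exprMn -exprM mulnC exprM thsq expr_div_n.
    rewrite exprS [leRHS](_ : _ = 2 ^+ j * (c * d ^+ 2 * M `^ p)); last first.
      by field; rewrite expf_neq0// gt_eqF.
    by rewrite dsq le_eqVlt; apply/orP; left; apply/eqP; ring.
  move=> y tau /andP[s1 s2] yx; apply: le_powR_norm.
    by rewrite mulr_ge0 ?exprn_ge0// ltW.
  apply: IH; first by apply/andP; split; lra.
  have := ler_enormD (y - x) x; rewrite subrK yx; lra.
pose j := (Num.truncn (u 0 L / M)).+1.
have : 2 ^+ j * M <= u 0 L.
  by apply: dbl; rewrite ?enorm0 ?subrr// tm_le lexx.
rewrite -ler_pdivlMr// leNgt => /negP; apply.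
apply: lt_le_trans (truncnS_gt _) _.
by rewrite -natrX ler_nat ltnW// ltn_expl.
Qed.

End Supersolution.

(** * Reduction to supersolutions *)

Section GammaPositivity.
Variable R : realType.
Local Notation mu := (@lebesgue_measure R).

Lemma powR_expR_le (a x : R) : 0 < a -> 0 < x ->
  x `^ a <= (2 * a) `^ a * expR (x / 2).
Proof.
move=> a0 x0; have a20 : 0 < 2 * a by rewrite mulr_gt0.
have -> : expR (x / 2) = expR (x / (2 * a)) `^ a.
  rewrite -expRM; congr expR; field; rewrite gt_eqF//.
rewrite -powRM ?expR_ge0 ?(ltW a20)//.
apply: ge0_ler_powR.
- exact: ltW.
- by rewrite nnegrE ltW.
- by rewrite nnegrE mulr_ge0 ?expR_ge0// ltW.
- have e : 2 * a * (x / (2 * a)) = x by field; rewrite gt_eqF.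
  by rewrite -[leLHS]e ler_pM2l// (le_trans _ (expR_ge1Dx _))// lerDr.
Qed.

Lemma Gamma_gt0 (s : R) : 1 < s -> 0 < Gamma s.
Proof.
move=> s1; have a0 : 0 < s - 1 by rewrite subr_gt0.
rewrite /Gamma Rintegral_mkcond /Rintegral.
set f := _ \_ _.
have f0 x : 0 <= f x.
  by rewrite /f patchE; case: ifP => // _; rewrite mulr_ge0 ?powR_ge0 ?expR_ge0.
pose C := 2 * (2 * (s - 1)) `^ (s - 1).
have C0 : 0 < C by rewrite mulr_gt0 ?powR_gt0 ?mulr_gt0.
have fE x : f x <= C * exponential_pdf (1 / 2) x.
  rewrite /f patchE; case: ifPn => [|_]; last first.
    by rewrite mulr_ge0 ?(ltW C0)// exponential_pdf_ge0.
  rewrite inE/= in_itv/= andbT => x0.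
  rewrite exponential_pdfE ?(ltW x0)//.
  have := powR_expR_le a0 x0; move=> /(ler_wpM2r (expR_ge0 (- x))) /le_trans; apply.
  rewrite -mulrA -expRD /C.
  rewrite (_ : x / 2 - x = - (1 / 2) * x); last by field.
  by rewrite le_eqVlt; apply/orP; left; apply/eqP; field.
have fin : (\int[mu]_x (f x)%:E)%E \is a fin_num.
  rewrite ge0_fin_numE; last by apply: integral_ge0 => x _; rewrite lee_fin.
  apply: (@le_lt_trans _ _ (\int[mu]_x (C * exponential_pdf (1 / 2) x)%:E)%E).
    by apply: ge0_le_integral_nonmeasurable => x; rewrite lee_fin.
  apply: le_lt_trans (@ge0_integralZ_le _ _ _ mu _ C _ C0) _.
    by move=> x; exact: exponential_pdf_ge0.
  by rewrite integral_exponential_pdf// mule1 ltry.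
rewrite fine_gt0// ltey_eq fin andbT.
apply: (@lt_le_trans _ _ (\int[mu]_x (if (1 <= x < 2)%R then expR (- 2) else 0)%:E)%E).
  by rewrite lebesgue_integral_itv_cst ?ler1n// lte_fin mulr_gt0 ?expR_gt0//; lra.
apply: ge0_le_integral_nonmeasurable => x; rewrite lee_fin; first by case: ifP => // _; exact: expR_ge0.
case: ifPn => // /andP[x1 x2]; rewrite /f patchE ifT; last by rewrite inE/= in_itv/= andbT; lra.
rewrite -[leLHS]mul1r; apply: ler_pM; rewrite ?expR_ge0//.
  by rewrite -[leLHS](powRr0 x) ler_powR// ltW.
by rewrite ler_expR; lra.
Qed.

Lemma omega_gt0 n : (3 <= n)%N -> 0 < omega R n.
Proof.
move=> n3; rewrite /omega divr_gt0// ?mulr_gt0 ?powR_gt0 ?pi_gt0//.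
apply: Gamma_gt0; rewrite ltr_pdivlMr// mul1r ltr_nat; exact: n3.
Qed.

End GammaPositivity.

Section Boundedness.
Variables (R : realType) (n : nat).

Lemma regular_sol_continuous (p T : R) (u : 'rV[R]_n -> R -> R) :
  regular_sol p T u -> forall x t, 0 <= t <= T ->
  {for (row_mx (const_mx t : 'rV_1) x), continuous (lift_xt u)}.
Proof.
move=> [d d0 reg] x t /andP[t0 tT].
have : - d < lsubmx (row_mx (const_mx t : 'rV[R]_1) x) ord0 ord0 < T + d.
  by rewrite row_mxKl mxE; apply/andP; split; lra.
by move: reg => /=; case: ifP => _; [move=> [[+ _] _]|move=> [+ _]]; exact.
Qed.

Lemma regular_sol_bounded (p T : R) (u : 'rV[R]_n -> R -> R) : 0 <= p ->
  regular_sol p T u -> forall x t, 0 <= t <= T ->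
  bounded_in_past (fun y s => `|u y s| `^ p) x t.
Proof.
move=> p0 reg x t /andP[t0 tT].
pose M := enorm x + t.
pose I (i : 'I_(1 + n)) : set R :=
  if i == ord0 then `[0, T]%classic else `[- M, M]%classic.
pose A := [set z : 'rV[R]_(1 + n) | forall i, I i (z ord0 i)].
have cA : compact A.
  by apply: rV_compact => i; rewrite /I; case: ifP => _; exact: segment_compact.
have zE (z : 'rV[R]_(1 + n)) : z = row_mx (const_mx (z ord0 ord0) : 'rV_1) (rsubmx z).
  rewrite -[LHS]hsubmxK; congr row_mx; apply/rowP => i.
  by rewrite ord1 !mxE; congr (z _ _); exact: val_inj.
have contA : {within A, continuous (lift_xt u)}.
  apply: continuous_in_subspaceT => z; rewrite inE => Az.
  rewrite (zE z); apply: regular_sol_continuous reg _ _ _.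
  by have := Az ord0; rewrite /I eqxx /= in_itv.
have [B [_ HB]] := compact_bounded (continuous_compact contA cA).
exists ((B + 1) `^ p) => s y /andP[s0 st] yM.
rewrite powR_ge0/=.
have uB : `|u y s| <= B + 1.
  apply: (HB (B + 1)); first by rewrite ltrDl.
  exists (row_mx (const_mx s : 'rV_1) y) => [i|]; last first.
    by rewrite /lift_xt row_mxKr row_mxKl mxE.
  rewrite /I; case: eqP => [->|/eqP i0].
    rewrite (_ : ord0 = lshift n (ord0 : 'I_1)); last exact: val_inj.
    by rewrite row_mxEl mxE /= in_itv/= s0 (le_trans st).
  case: (unliftP (ord0 : 'I_(1 + n)) i) => [j ij|e]; last by rewrite e eqxx in i0.
  rewrite (_ : i = rshift 1 j); last by rewrite ij; exact: val_inj.
  by rewrite row_mxEr /= in_itv/= -ler_norml (le_trans (le_coord_enorm _ _)).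
by apply: ge0_ler_powR; rewrite ?nnegrE// (le_trans _ uB).
Qed.

End Boundedness.

Lemma far_point (R : realType) n (x w : 'rV[R]_n) t : 0 <= t -> enorm w = 1 ->
  t - enorm x <= enorm (x + t *: w).
Proof.
move=> t0 w1; have := ler_enormB (t *: w) (- x).
by rewrite opprK enormN enormZ w1 mulr1 ger0_norm// (addrC x).
Qed.

Section FreeWave.
Variables (R : realType) (g0 : R -> R) (k k0 : R).
Local Notation mu := (@lebesgue_measure R).

Lemma Rintegral_ge0_off0 (f : R -> R) : (forall s, s != 0 -> 0 <= f s) ->
  0 <= Rintegral mu setT f.
Proof.
move=> f0; apply: fine_ge0; rewrite integralE.
rewrite [X in (_ - X)%E](_ : _ = 0%E).
  by rewrite sube0 integral_ge0.
apply/eqP; rewrite eq_le integral_ge0 ?andbT//.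
rewrite -(@integral_set1 R (cst `|f 0|%:E) 0) [leRHS]integral_mkcond.
apply: ge0_le_integral_nonmeasurable => s //.
rewrite patchE; case: ifPn => [|s0].
  by rewrite inE => ->; rewrite funenegE /= -EFin_max lee_fin ge_max normr_ge0 -normrN ler_norm.
have {}s0 : s != 0 by apply: contra s0 => /eqP->; rewrite inE.
by rewrite funenegE /= -EFin_max lee_fin ge_max lexx andbT oppr_le0 f0.
Qed.

Lemma C2_halfline_continuous : C2_halfline g0 ->
  exists G : R -> R, continuous G /\ forall r, 0 <= r -> G r = g0 r.
Proof.
move=> [G [dG [_ [_ Gg]]]]; exists G; split => // r.
by apply: differentiable_continuous; apply/derivable1_diffP; exact: dG.
Qed.

Hypotheses (Cg : C2_halfline g0) (kpos : 0 < k) (gk : forall r, k < r -> g0 r = 0).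
Hypotheses (k0pos : 0 < k0) (k0k : k0 < k) (gpos : forall r, k0 < r < k -> 0 < g0 r).

Lemma profile_ge0 (r : R) : k0 < r -> 0 <= g0 r.
Proof.
move=> k0r; case: (ltgtP r k) => [rk|/gk->//|->].
  by rewrite ltW// gpos// k0r.
have [G [cG Gg]] := C2_halfline_continuous Cg.
rewrite -Gg ?(ltW kpos)// leNgt; apply/negP => Gk.
have Gk' : 0 < - G k by rewrite oppr_gt0.
have /cvgrPdist_lt/(_ _ Gk')/nbhs_ballP[e /= e0 He] := cG k.
have /He : ball k e (k + e / 2).
  rewrite /ball/= opprD addrA subrr add0r normrN gtr0_norm ?divr_gt0//.
  by rewrite ltr_pdivrMr// ltr_pMr// ltr1n.
rewrite /= (Gg (k + _)) ?gk ?ltrDl ?divr_gt0 ?subr0//; last first.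
  by rewrite addr_ge0 ?divr_ge0 ?ltW.
by rewrite ltr0_norm ?ltxx.
Qed.

Lemma profile_bounded : exists B, forall r, 0 <= r -> g0 r <= B.
Proof.
have [G [cG Gg]] := C2_halfline_continuous Cg.
have [c _ Hc] := @EVT_max R G 0 k (ltW kpos) (continuous_subspaceT cG).
exists (Num.max (G c) 0) => r r0; rewrite le_max; have [rk|/gk->] := leP r k.
  by rewrite -Gg// Hc// in_itv/= r0.
by rewrite lexx orbT.
Qed.

Lemma profile_pos_lower (a b : R) : k0 < a -> a <= b -> b < k ->
  exists2 m, 0 < m & forall r, a <= r <= b -> m <= g0 r.
Proof.
move=> k0a ab bk; have [G [cG Gg]] := C2_halfline_continuous Cg.
have [c cab Hc] := @EVT_min R G a b ab (continuous_subspaceT cG).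
move: cab; rewrite in_itv/= => /andP[ac cb].
exists (G c) => [|r /andP[ar rb]].
  rewrite Gg; first by apply: gpos; apply/andP; split; lra.
  exact: le_trans (ltW (lt_trans k0pos k0a)) ac.
rewrite -Gg; first by apply: Hc; rewrite in_itv/= ar.
exact: le_trans (ltW (lt_trans k0pos k0a)) ar.
Qed.

Variable n : nat.
Let g (x : 'rV[R]_n) := g0 (enorm x).

Lemma VlinE (x : 'rV[R]_n) t : Vlin (fun=> 0) g x t =
  (omega R n)^-1 * (n%:R * intRn (fun y : 'rV[R]_n =>
    if enorm y <= 1 then t * g (x + t *: ((enorm y)^-1 *: y)) else 0)).
Proof.
rewrite /Vlin /sphint; congr (_ * (_ * _)); congr intRn; apply/funext => y.
by rewrite derive_cst mulr0 mul0r !add0r.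
Qed.

Hypothesis n3 : (3 <= n)%N.
Let n0 : (0 < n)%N. Proof. exact: leq_trans n3. Qed.

(* At [y = 0] the junk value [0^-1 *: 0 = 0] makes the integrand [t * g x],
   possibly negative; this only affects the slice through the origin. *)
Lemma Vlin_ge0 (x : 'rV[R]_n) (t : R) : 0 <= t -> k0 < t - enorm x ->
  0 <= Vlin (fun=> 0) g x t.
Proof.
move=> t0 tx; rewrite VlinE; apply: mulr_ge0.
  by rewrite invr_ge0 ltW// omega_gt0.
apply: mulr_ge0 => //.
move: n3 x tx; rewrite /g; case: (n) => [//|m] _ x tx.
apply: Rintegral_ge0_off0 => s s0; apply: intRn_ge0 => y.
case: ifP => // _; apply: mulr_ge0 => //; apply: profile_ge0.
apply: lt_le_trans tx _; apply: far_point => //.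
apply: enorm_normalize; apply: contra_neq s0 => y0.
have := congr1 (fun v : 'rV[R]_(1 + m) => v ord0 (lshift m ord0)) y0.
by rewrite row_mxEl !mxE.
Qed.

Lemma Vlin_lower : exists a b cV t0 : R, [/\ k0 < a, a < b, 0 < cV, 0 < t0 &
  forall (x : 'rV[R]_n) (t : R), t0 <= t -> a <= t - enorm x <= b ->
    cV / t ^+ (n - 2) <= Vlin (fun=> 0) g x t].
Proof.
pose a := (3 * k0 + k) / 4; pose b := (k0 + k) / 2; pose b' := (k0 + 3 * k) / 4.
have kk : k0 < k := k0k.
have kp : 0 < k := kpos.
have k0p : 0 < k0 := k0pos.
have ka : k0 < a by rewrite /a; lra.
have ab : a < b by rewrite /a /b; lra.
have bb' : b < b' by rewrite /b /b'; lra.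
have b'k : b' < k by rewrite /b'; lra.
have [m m0 Hm] := profile_pos_lower ka (ltW (lt_trans ab bb')) b'k.
have [B HB] := profile_bounded.
have om := @omega_gt0 R n n3.
have nR : 0 < n%:R :> R by rewrite ltr0n.
pose del := b' - b; have del0 : 0 < del by rewrite subr_gt0.
exists a, b, ((omega R n)^-1 * (n%:R * (capc R n * del ^+ n.-1 * m))), (del + b + k).
split => //.
- apply: mulr_gt0; first by rewrite invr_gt0.
  apply: mulr_gt0 => //; apply: mulr_gt0 => //.
  by apply: mulr_gt0; [exact: capc_gt0|exact: exprn_gt0].
- lra.
move=> x t tt0 /andP[ax xb].
have t0 : 0 < t by lra.
set r := enorm x in ax xb.
have r0 : 0 < r by lra.
pose w := - (r^-1 *: x).
have w1 : enorm w = 1.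
  by rewrite enormN enormZ ger0_norm ?invr_ge0 ?(ltW r0)// mulVf// gt_eqF.
have xw : x = (- r) *: w by rewrite scaleNr scalerN opprK scalerA mulfV ?scale1r// gt_eqF.
have posg y : 0 <= g (x + t *: ((enorm y)^-1 *: y)).
  apply: profile_ge0; have [->|y0] := eqVneq y 0.
    by rewrite !scaler0 addr0 -/r; lra.
  have := far_point x (ltW t0) (enorm_normalize y0); rewrite -/r; lra.
rewrite VlinE -[leLHS]mulrA ler_pM2l ?invr_gt0// -[leLHS]mulrA ler_pM2l//.
have th01 : 0 < del / t <= 1 by rewrite divr_gt0//= ler_pdivrMr// mul1r; lra.
have := @ler_cap_intRn R n n0 (fun y : 'rV[R]_n =>
    if enorm y <= 1 then t * g (x + t *: ((enorm y)^-1 *: y)) else 0)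
    w (del / t) (t * m) _ w1 th01.
move=> h; apply: le_trans (h _ _ _).
- have -> : t ^+ (n - 2) = t ^+ n.-1 / t.
    have -> : n.-1 = (n - 2).+1 by move: n3; case: (n) => [|[|j]]//= _; rewrite !subSS subn0.
    by rewrite exprSr mulfK// gt_eqF.
  rewrite expr_div_n le_eqVlt; apply/orP; left; apply/eqP; field.
  by rewrite expf_neq0 gt_eqF.
- apply: (@bdsupp_unit_ball _ _ _ (t * B)) => y y1.
  by rewrite mulr_ge0 ?(ltW t0)//= ler_pM2l// HB// enorm_ge0.
- by rewrite mulr_ge0 ?(ltW t0)// ltW.
move=> y [y8 y1 yw]; rewrite y1 ler_pM2l//; apply: Hm.
have y0 : y != 0 by apply: contraTneq y8 => ->; rewrite enorm0 -ltNge; lra.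
have w'1 := enorm_normalize y0.
set w' := (enorm y)^-1 *: y in yw w'1 *.
have f1 := far_point x (ltW t0) w'1; rewrite -/r in f1.
apply/andP; split; first lra.
have -> : x + t *: w' = (t - r) *: w + t *: (w' - w).
  by rewrite {1}xw scalerBr scalerBl -scaleNr [RHS]addrC addrA subrK addrC.
rewrite (le_trans (ler_enormD _ _))// !enormZ w1 mulr1 !ger0_norm ?(ltW t0)//; last lra.
have : t * enorm (w' - w) <= del.
  by rewrite -ler_pdivlMl// mulrC.
rewrite /del; lra.
Qed.

End FreeWave.

(** * Lifespan estimates *)

Section PowerIdentities.
Variable R : realType.

Lemma expR_ex (x : R) : 0 < x -> exists l, x = expR l.
Proof. by move=> x0; exists (ln x); rewrite lnK. Qed.

Let expE := (=^~ @expRM_natl R, =^~ @expRN R, =^~ @expRD R, =^~ @expRM R).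

Lemma natr_sub2 n : (3 <= n)%N -> (n - 2)%:R = n%:R - 2 :> R.
Proof. by move=> n3; rewrite natrB// ltnW. Qed.

Lemma natr_pred n : (3 <= n)%N -> n.-1%:R = n%:R - 1 :> R.
Proof. by case: n => // n _; rewrite -[in RHS]natr1 addrK. Qed.

Lemma strip_blowup_identity n (p c1 eps cV w L : R) : (3 <= n)%N ->
  0 < c1 -> 0 < eps -> 0 < cV -> 0 < w -> 0 < L ->
  (c1 * ((eps * cV / L ^+ (n - 2)) `^ p * w * L)) `^ (p - 1) * L ^+ 2 =
  (c1 * (cV `^ p * w)) `^ (p - 1) * eps `^ (p * (p - 1)) * L `^ (zeta p n / 2).
Proof.
move=> n3 /expR_ex[c1' ->] /expR_ex[e' ->] /expR_ex[cV' ->] /expR_ex[w' ->] /expR_ex[L' ->].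
rewrite !expE natr_sub2// /zeta; congr expR; by field.
Qed.

Lemma strip_cone_identity n (p c2 eps cV w r s th : R) : (3 <= n)%N ->
  0 < c2 -> 0 < eps -> 0 < cV -> 0 < w -> 0 < r -> 0 < s -> 0 < th ->
  c2 * ((s / r) ^+ n.-1 * r * ((eps * cV / (th * s) ^+ (n - 2)) `^ p * w)) =
  c2 * w * cV `^ p * th `^ (- ((n%:R - 2) * p)) * eps `^ p *
   r `^ (- (n%:R - 2)) * s `^ (- ((n%:R - 2) * p - (n%:R - 1))).
Proof.
move=> n3 /expR_ex[c' ->] /expR_ex[e' ->] /expR_ex[cV' ->] /expR_ex[w' ->] /expR_ex[r' ->] /expR_ex[s' ->] /expR_ex[th' ->].
rewrite !expE natr_sub2// natr_pred//; congr expR; by ring.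
Qed.

Variables (n : nat) (p q : R).
Hypotheses (n3 : (3 <= n)%N) (qE : q = (n%:R - 2) * p - (n%:R - 1)) (pq : p * q = 1).

Lemma slice_identity (Y s b two : R) : 0 < Y -> 0 < s -> 0 < b -> 0 < two ->
  (Y * (two * s) `^ (- (n%:R - 2)) * (two * b) `^ (- q)) `^ p * b =
  Y `^ p * (two * s) `^ (- ((n%:R - 2) * p)) / two.
Proof.
move=> /expR_ex[Y' ->] /expR_ex[s' ->] /expR_ex[b' ->] /expR_ex[w' ->].
rewrite !expE; congr expR; apply/eqP; rewrite -subr_eq0; apply/eqP.
transitivity ((1 - p * q) * (b' + w')); first by ring.
by rewrite pq subrr mul0r.
Qed.

Lemma cone_step_identity (c2 r s Y d two : R) :
  0 < c2 -> 0 < r -> 0 < s -> 0 < Y -> 0 < d -> 0 < two ->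
  c2 * ((s / r) ^+ n.-1 * r * (d * (Y `^ p * (two * s) `^ (- ((n%:R - 2) * p)) / two))) =
  (c2 * two `^ (- ((n%:R - 2) * p)) / two) * d * Y `^ p *
    r `^ (- (n%:R - 2)) * s `^ (- q).
Proof.
move=> /expR_ex[c' ->] /expR_ex[r' ->] /expR_ex[s' ->] /expR_ex[Y' ->] /expR_ex[d' ->] /expR_ex[w' ->].
rewrite !expE natr_pred// qE; congr expR; by ring.
Qed.

Lemma cone_blowup_identity (c1 Y s a two : R) :
  0 < c1 -> 0 < Y -> 0 < s -> 0 < a -> 0 < two ->
  (c1 * ((Y * (a * s) `^ (- (n%:R - 2)) * (two * s) `^ (- q)) `^ p * s * (a * s))) `^ (p - 1)
    * (a * s) ^+ 2 =
  (c1 * ((a `^ (- (n%:R - 2)) * two `^ (- q)) `^ p * a)) `^ (p - 1) * a ^+ 2 * Y `^ (p * (p - 1)).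
Proof.
move=> /expR_ex[c' ->] /expR_ex[Y' ->] /expR_ex[s' ->] /expR_ex[a' ->] /expR_ex[w' ->].
rewrite !expE; congr expR; apply/eqP; rewrite -subr_eq0; apply/eqP.
have Z : p * ((n%:R - 2) * p - (n%:R - 1)) = 1 by rewrite -qE.
rewrite qE.
transitivity (p * (1 - p * ((n%:R - 2) * p - (n%:R - 1))) * s'); first by ring.
by rewrite Z subrr mulr0 mul0r.
Qed.

End PowerIdentities.

Lemma exists_unit_vector (R : realType) n : (0 < n)%N -> exists w : 'rV[R]_n, enorm w = 1.
Proof.
move=> n0; have v0 : (const_mx 1 : 'rV[R]_n) != 0.
  apply/eqP => /rowP/(_ (Ordinal n0)) /eqP; by rewrite !mxE oner_eq0.
by exists ((enorm (const_mx 1 : 'rV[R]_n))^-1 *: const_mx 1); exact: enorm_normalize.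
Qed.

Section Lifespan.
Variables (R : realType) (n : nat) (p kap cN : R).
Hypotheses (n3 : (3 <= n)%N) (p1 : 1 < p) (kap0 : 0 < kap) (cN0 : 0 < cN).
Let n0 : (0 < n)%N. Proof. exact: leq_trans n3. Qed.
Implicit Types (u : 'rV[R]_n -> R -> R) (T L : R).

Definition supersolution T u :=
  (forall (x : 'rV[R]_n) (t : R), 0 <= t <= T ->
     bounded_in_past (fun y tau => `|u y tau| `^ p) x t) /\
  (forall (x : 'rV[R]_n) (t : R), 0 <= t <= T -> kap < t - enorm x ->
     cN * retarded (fun y tau => `|u y tau| `^ p) x t <= u x t).

Lemma supersolution_lifespan T u L b1 b2 K : supersolution T u ->
  0 < L <= T -> kap < L / 2 -> 0 <= b1 < b2 -> b2 <= L / 16 -> 0 < K ->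
  (forall (y : 'rV[R]_n) (tau : R), 0 <= tau <= L -> b1 <= tau - enorm y <= b2 ->
     L / 8 <= enorm y -> K <= u y tau) ->
  (interior_const n cN * (K `^ p * (b2 - b1) * L)) `^ (p - 1) * L ^+ 2
    < blowup_const n p cN.
Proof.
move=> [bG uN] LT kL b12 bL K0 H; rewrite ltNge; apply/negP => cond.
have [w w1] := exists_unit_vector R n0.
have M0 : 0 < interior_const n cN * (K `^ p * (b2 - b1) * L).
  apply: mulr_gt0; first exact: interior_const_gt0.
  case/andP: LT => L0 _; case/andP: b12 => _ b12.
  by rewrite !mulr_gt0 ?powR_gt0// subr_gt0.
apply: (blowup_in_cone n0 p1 cN0 bG uN w1 LT kL M0 cond).
exact: (interior_lower_bound n0 p1 cN0 bG uN w1 LT kL b12 bL (ltW K0) H).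
Qed.

Definition strip_bound (a b cV t0 eps T : R) u :=
  forall (x : 'rV[R]_n) (t : R), t0 <= t <= T -> a <= t - enorm x <= b ->
    eps * cV / t ^+ (n - 2) <= u x t.

Lemma subcritical_lifespan (a b cV t0 : R) : kap < a -> a < b -> 0 < cV -> 0 < t0 ->
  0 < zeta p n ->
  exists2 C : R, 0 < C & forall (eps T : R) u, 0 < eps <= 1 -> supersolution T u ->
    strip_bound a b cV t0 eps T u ->
    T <= C * eps `^ (- (2 * p * (p - 1) / zeta p n)).
Proof.
move=> ka ab cV0 t00 z0.
have pp : 1 < p := p1.
have kp : 0 < kap := kap0.
have c1 : 0 < interior_const n cN by exact: interior_const_gt0.
pose D := (interior_const n cN * (cV `^ p * (b - a))) `^ (p - 1).
have D0 : 0 < D.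
  by rewrite powR_gt0// mulr_gt0// mulr_gt0 ?powR_gt0// subr_gt0.
have bc0 : 0 < blowup_const n p cN.
  have th1 : blowup_ratio p < 1 by case/andP: (blowup_ratio_bounds p1).
  rewrite divr_gt0//; apply: mulr_gt0; first exact: doubling_const_gt0.
  by rewrite exprn_gt0// subr_gt0.
pose C := 16 * b + 8 * t0 + (blowup_const n p cN / D) `^ (2 / zeta p n).
have X0 : 0 < (blowup_const n p cN / D) `^ (2 / zeta p n) by rewrite powR_gt0// divr_gt0.
have C0 : 0 < C by rewrite /C; lra.
exists C => // eps T u /andP[e0 e1] su strip; rewrite leNgt; apply/negP.
set L := C * _ => LT.
have E1 : 1 <= eps `^ (- (2 * p * (p - 1) / zeta p n)).
  rewrite powRN invf_ge1 ?powR_gt0// -[leRHS](powRr0 eps) ger_powR ?e0//.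
  by apply: divr_ge0; [apply: mulr_ge0; lra|exact: ltW].
have CL : C <= L by rewrite ler_peMr// ltW.
have L0 : 0 < L by exact: lt_le_trans CL.
have K0 : 0 < eps * cV / L ^+ (n - 2) by rewrite divr_gt0 ?mulr_gt0 ?exprn_gt0.
have := @supersolution_lifespan T u L a b (eps * cV / L ^+ (n - 2)) su.
have -> : 0 < L <= T by rewrite L0 ltW.
have bL : b <= L / 16 by rewrite /C in CL; lra.
have tL : t0 <= L / 8 by rewrite /C in CL; lra.
rewrite bL K0 ab (_ : kap < L / 2); last lra.
rewrite (_ : 0 <= a); last lra.
move=> /(_ isT isT isT isT isT) h.
have : (forall (y : 'rV[R]_n) (tau : R), 0 <= tau <= L -> a <= tau - enorm y <= b ->
     L / 8 <= enorm y -> eps * cV / L ^+ (n - 2) <= u y tau).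
  move=> y tau /andP[tau0 tauL] /[dup] ph /andP[ph1 ph2] yL.
  apply: le_trans (strip y tau _ ph); last by apply/andP; split; lra.
  rewrite ler_pM2l ?mulr_gt0// lef_pV2 ?posrE ?exprn_gt0//; last lra.
  by rewrite lerXn2r// ?nnegrE// ltW.
move=> /h; rewrite strip_blowup_identity// ?subr_gt0//.
rewrite ltNge => /negP; apply; rewrite -/D.
have -> : L `^ (zeta p n / 2) = C `^ (zeta p n / 2) * eps `^ (- (p * (p - 1))).
  rewrite /L powRM ?powR_ge0 ?(ltW C0)// -powRrM; congr (_ * _ `^ _).
  by field; rewrite gt_eqF.
rewrite mulrACA powRN mulfV ?gt_eqF ?powR_gt0// mulr1.
rewrite mulrC -ler_pdivrMr//.
have -> : blowup_const n p cN / D = ((blowup_const n p cN / D) `^ (2 / zeta p n)) `^ (zeta p n / 2).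
  rewrite -powRrM (_ : 2 / zeta p n * (zeta p n / 2) = 1).
    by rewrite powRr1// divr_ge0// ltW.
  by field; rewrite gt_eqF.
apply: ge0_ler_powR; rewrite ?nnegrE ?(ltW C0) ?(ltW X0)//.
  by apply: divr_ge0 => //; exact: ltW.
by rewrite /C; lra.
Qed.

End Lifespan.

Section Critical.
Variables (R : realType) (n : nat) (p kap cN : R).
Hypotheses (n3 : (3 <= n)%N) (p1 : 1 < p) (kap0 : 0 < kap) (cN0 : 0 < cN).
Let n0 : (0 < n)%N. Proof. exact: leq_trans n3. Qed.
Let q := (n%:R - 2) * p - (n%:R - 1).
Hypothesis pq : p * q = 1.
Implicit Types (u : 'rV[R]_n -> R -> R) (T L Y sg : R).

Let q0 : 0 <= q.
Proof.
have pp : 0 < p by exact: lt_trans p1.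
by rewrite -(pmulr_rge0 _ pp) pq.
Qed.

Let m0 : 0 <= n%:R - 2 :> R.
Proof. by rewrite subr_ge0 ler_nat ltnW. Qed.

Definition cone_bound T u Y sg := forall (x : 'rV[R]_n) (t : R),
  t <= T -> sg <= t - enorm x -> t - enorm x <= enorm x ->
  Y * enorm x `^ (- (n%:R - 2)) * (t - enorm x) `^ (- q) <= u x t.

Lemma ler_powRN (e a b : R) : 0 <= e -> 0 < a -> a <= b -> b `^ (- e) <= a `^ (- e).
Proof.
move=> e0 a0 ab; have b0 : 0 < b by exact: lt_le_trans ab.
rewrite !powRN lef_pV2 ?posrE ?powR_gt0//.
by apply: ge0_ler_powR; rewrite ?nnegrE// ltW.
Qed.

Lemma cone_bound_start (a b cV t0 : R) : kap < a -> a < b -> 0 < cV -> 0 < t0 ->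
  exists2 cY : R, 0 < cY & exists2 s0 : R, kap < s0 &
  forall (eps T : R) u, 0 < eps -> supersolution p kap cN T u ->
    strip_bound a b cV t0 eps T u -> cone_bound T u (cY * eps `^ p) s0.
Proof.
move=> ka ab cV0 t00.
have kp : 0 < kap := kap0.
have c2 : 0 < cone_const n cN by exact: cone_const_gt0.
have [s0 s0E] : exists s0, s0 = 2 * b + 4 * t0 by exists (2 * b + 4 * t0).
exists (cone_const n cN * (b - a) * cV `^ p * 3 `^ (- ((n%:R - 2) * p))).
  by apply: mulr_gt0; rewrite ?powR_gt0//; apply: mulr_gt0; rewrite ?powR_gt0// mulr_gt0// subr_gt0.
exists s0; first by lra.
move=> eps T u e0 [bG uN] strip x t tT sx xx.
have [s sE] : exists s, s = t - enorm x by exists (t - enorm x).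
rewrite -sE in sx xx *.
have s_gt0 : 0 < s by lra.
have x0 := enorm_ge0 x.
have tT' : 0 <= t <= T by apply/andP; split; lra.
pose K := eps * cV / (3 * s) ^+ (n - 2).
have K0 : 0 < K by rewrite divr_gt0 ?mulr_gt0 ?exprn_gt0 ?mulr_gt0.
have := @cone_lower_bound R n n0 p kap cN T u p1 cN0 bG uN x t s 1
  (fun i => a + i%:R * (b - a)) (fun=> K) sE tT'.
rewrite big_ord1 mul1r mul0r addr0 (addrC a) addrK subrK => h.
have {h} : cone_const n cN * ((s / enorm x) ^+ n.-1 * enorm x * (K `^ p * (b - a))) <= u x t.
  apply: h; [lra|lra|lra|lra|by move=> i; rewrite -natr1; lra|lra|by move=> _; exact: ltW|].
  move=> y tau i; rewrite ltnS leqn0 => /eqP-> /andP[tau0 taut].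
  rewrite mul0r mul1r addr0 (addrC a) subrK => /[dup] ph /andP[ph1 ph2] /andP[y1 y2].
  apply: le_trans (strip y tau _ ph); last by apply/andP; split; lra.
  rewrite ler_pM2l ?mulr_gt0// lef_pV2 ?posrE ?exprn_gt0//; try lra.
  by rewrite lerXn2r// ?nnegrE; lra.
apply: le_trans; rewrite /K strip_cone_identity// ?subr_gt0//; last lra.
Qed.

Lemma cone_bound_step : exists2 c4 : R, 0 < c4 & forall (T : R) u (Y sg : R) (D : nat),
  supersolution p kap cN T u -> kap < sg -> 0 < Y -> (0 < D)%N ->
  cone_bound T u Y sg -> cone_bound T u (c4 * D%:R * Y `^ p) (4 * (2 ^+ D * sg)).
Proof.
have kp : 0 < kap := kap0.
have c2 : 0 < cone_const n cN by exact: cone_const_gt0.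
exists (cone_const n cN * 2 `^ (- ((n%:R - 2) * p)) / 2).
  by rewrite divr_gt0// mulr_gt0// powR_gt0.
move=> T u Y sg D [bG uN] ksg Y0 D0 HY x t tT sx xx.
have [s sE] : exists s, s = t - enorm x by exists (t - enorm x).
rewrite -sE in sx xx *.
have sg0 : 0 < sg by lra.
have Dsg : 0 < 2 ^+ D * sg by rewrite mulr_gt0// exprn_gt0.
have sgD : sg <= 2 ^+ D * sg by rewrite ler_peMl ?(ltW sg0)// exprn_ege1// ler1n.
have s_gt0 : 0 < s by lra.
have x0 := enorm_ge0 x.
have tT' : 0 <= t <= T by apply/andP; split; lra.
pose b i : R := 2 ^+ i * sg.
have b0 i : 0 < b i by rewrite mulr_gt0// exprn_gt0.
have bE i : b i.+1 = 2 * b i by rewrite /b exprS mulrA.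
have bm i j : (i <= j)%N -> b i <= b j.
  apply: (@homo_leq _ b (fun x1 x2 => x1 <= x2)) => // [x1 x2 x3|i']; first exact: le_trans.
  by rewrite bE; have := b0 i'; lra.
have bD : b D = 2 ^+ D * sg by [].
pose K i := Y * (2 * s) `^ (- (n%:R - 2)) * (2 * b i) `^ (- q).
have K0 i : 0 <= K i by rewrite !mulr_ge0 ?powR_ge0// ltW.
have := @cone_lower_bound R n n0 p kap cN T u p1 cN0 bG uN x t s D b K sE tT'.
move=> h; have {h} : cone_const n cN * ((s / enorm x) ^+ n.-1 * enorm x *
    (\sum_(i < D) K i `^ p * (b i.+1 - b i))) <= u x t.
  apply: h; [lra|lra|lra|exact: ltW|by move=> i; rewrite bE; have := b0 i; lra|by rewrite bD; lra|by []|].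
  move=> y tau i iD /andP[tau0 taut] /andP[ph1 ph2] /andP[y1 y2].
  have bi := b0 i; have biD := bm _ _ iD; have b0i := bm 0%N i isT.
  rewrite {1}/b expr0 mul1r in b0i.
  apply: le_trans (HY y tau _ _ _); try lra.
  rewrite /K -!mulrA ler_pM2l//; apply: ler_pM; rewrite ?powR_ge0//.
    by apply: ler_powRN => //; lra.
  by apply: ler_powRN => //; rewrite -?bE; lra.
apply: le_trans.
have -> : \sum_(i < D) K i `^ p * (b i.+1 - b i) =
    D%:R * (Y `^ p * (2 * s) `^ (- ((n%:R - 2) * p)) / 2).
  rewrite (eq_bigr (fun=> Y `^ p * (2 * s) `^ (- ((n%:R - 2) * p)) / 2)).
    by rewrite sumr_const card_ord -[LHS]mulr_natl.
  move=> i _; rewrite bE (_ : 2 * b i - b i = b i); last by ring.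
  by rewrite (@slice_identity R n p q pq).
rewrite (@cone_step_identity R n p q n3 erefl)// ?ltr0n//; lra.
Qed.

Lemma cone_bound_end : exists2 Y1 : R, 0 < Y1 & forall (T : R) u (Y sg : R),
  supersolution p kap cN T u -> kap < sg -> Y1 <= Y -> cone_bound T u Y sg ->
  T < 32 * sg.
Proof.
have kp : 0 < kap := kap0.
have pp : 1 < p := p1.
have c1 : 0 < interior_const n cN by exact: interior_const_gt0.
pose c5 := (interior_const n cN * ((32 `^ (- (n%:R - 2)) * 2 `^ (- q)) `^ p * 32)) `^ (p - 1) * 32 ^+ 2.
have c50 : 0 < c5.
  apply: mulr_gt0; last by rewrite exprn_gt0.
  by apply: powR_gt0; apply: mulr_gt0 => //; rewrite mulr_gt0// powR_gt0// mulr_gt0// powR_gt0.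
have bc0 : 0 < blowup_const n p cN.
  have th1 : blowup_ratio p < 1 by case/andP: (blowup_ratio_bounds p1).
  rewrite divr_gt0//; apply: mulr_gt0; first exact: doubling_const_gt0.
  by rewrite exprn_gt0// subr_gt0.
have e0 : 0 < p * (p - 1) by rewrite mulr_gt0; lra.
exists ((blowup_const n p cN / c5) `^ (p * (p - 1))^-1); first by rewrite powR_gt0// divr_gt0.
move=> T u Y sg su ksg Y1Y HY; rewrite ltNge; apply/negP => LT.
have sg0 : 0 < sg by lra.
have Y0 : 0 < Y by apply: lt_le_trans Y1Y; rewrite powR_gt0// divr_gt0.
pose K := Y * (32 * sg) `^ (- (n%:R - 2)) * (2 * sg) `^ (- q).
have K0 : 0 < K by rewrite mulr_gt0 ?powR_gt0 ?mulr_gt0// powR_gt0 ?mulr_gt0.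
have := @supersolution_lifespan R n p kap cN n3 p1 cN0 T u (32 * sg) sg (2 * sg) K su.
move=> h.
have {h} : (interior_const n cN * (K `^ p * (2 * sg - sg) * (32 * sg))) `^ (p - 1) * (32 * sg) ^+ 2
    < blowup_const n p cN.
  apply: h; [by apply/andP; split; lra|lra|by apply/andP; split; lra|lra|by []|].
  move=> y tau /andP[tau0 tauL] /andP[ph1 ph2] yL.
  apply: le_trans (HY y tau _ _ _); try lra.
  rewrite /K -!mulrA ler_pM2l//; apply: ler_pM; rewrite ?powR_ge0//.
    by apply: ler_powRN => //; lra.
  by apply: ler_powRN => //; lra.
rewrite (_ : 2 * sg - sg = sg); last by ring.
rewrite /K (@cone_blowup_identity R n p q erefl pq)// -/c5 ltNge => /negP; apply.
rewrite mulrC -ler_pdivrMr//.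
have -> : blowup_const n p cN / c5 = ((blowup_const n p cN / c5) `^ (p * (p - 1))^-1) `^ (p * (p - 1)).
  by rewrite -powRrM mulVf ?gt_eqF// powRr1// divr_ge0// ltW.
apply: ge0_ler_powR; rewrite ?nnegrE ?powR_ge0 ?(ltW Y0)//.
exact: ltW.
Qed.

Lemma critical_lifespan (a b cV t0 : R) : kap < a -> a < b -> 0 < cV -> 0 < t0 ->
  exists2 C : R, 0 < C & forall (eps T : R) u, 0 < eps <= 1 -> supersolution p kap cN T u ->
    strip_bound a b cV t0 eps T u ->
    T <= expR (C * eps `^ (- (p * (p - 1)))).
Proof.
move=> ka ab cV0 t00.
have kp : 0 < kap := kap0.
have pp : 1 < p := p1.
have [cY cY0 [s0 ks0 Hstart]] := cone_bound_start ka ab cV0 t00.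
have [c4 c40 Hstep] := cone_bound_step.
have [Y1 Y10 Hend] := cone_bound_end.
have s00 : 0 < s0 by lra.
pose rho : R := 2 `^ (1 - p).
have rho0 : 0 < rho by rewrite powR_gt0.
have rho1 : rho < 1.
  rewrite -(powRr0 2) /rho /powR gt_eqF// ltr_expR ltr_pM2r ?ln_gt0 ?ltr1n//; lra.
pose A := 3 * Y1 `^ (p - 1) + 2 / c4.
have A0 : 0 < A by rewrite addr_gt0 ?divr_gt0// mulr_gt0// powR_gt0.
have ln20 : 0 < ln 2 :> R by rewrite ln_gt0// ltr1n.
pose B := ln 2 * (A * cY `^ (1 - p) / (1 - rho)).
have B0 : 0 < B.
  apply: mulr_gt0 => //; rewrite divr_gt0 ?subr_gt0//.
  by rewrite mulr_gt0// powR_gt0.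
exists (`|ln (32 * s0)| + B); first by rewrite ltr_wpDl.
move=> eps T u /andP[e0 e1] su strip.
pose Y j : R := 2 ^+ j * (cY * eps `^ p).
have Y00 : 0 < cY * eps `^ p by rewrite mulr_gt0// powR_gt0.
have Y0 j : 0 < Y j by rewrite mulr_gt0// exprn_gt0.
pose Z := (cY * eps `^ p) `^ (1 - p).
have Z0 : 0 < Z by rewrite powR_gt0.
have YZ j : Y j `^ (1 - p) = rho ^+ j * Z.
  rewrite /Y powRM ?exprn_ge0 ?(ltW Y00)//; congr (_ * _).
  exact: powR_exp2.
have main j : (forall i, (i < j)%N -> Y i < Y1) ->
    exists2 sg, s0 <= sg <= s0 * expR (ln 2 * (A * Z * ((1 - rho ^+ j) / (1 - rho)))) &
      cone_bound T u (Y j) sg.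
  elim: j => [_|j IH Hj].
    exists s0; first by rewrite expr0 subrr mul0r !mulr0 expR0 mulr1 lexx.
    by rewrite /Y expr0 mul1r; exact: Hstart strip.
  have [|sg /andP[s0sg sgle] HY] := IH; first by move=> i ij; exact: Hj (ltnW ij).
  have YjY1 := Hj j (ltnSn j).
  pose D := (Num.truncn (2 / c4 * Y j `^ (1 - p))).+1.
  have Dge : 2 / c4 * Y j `^ (1 - p) <= D%:R by rewrite ltW// truncnS_gt.
  have Dle : D%:R <= 1 + 2 / c4 * Y j `^ (1 - p).
    rewrite -[D%:R]natr1 addrC lerD2l truncn_le// mulr_ge0 ?powR_ge0//.
    by rewrite divr_ge0// ltW.
  have one : 1 <= Y1 `^ (p - 1) * Y j `^ (1 - p).
    rewrite -[1 - p]opprB powRN -ler_pdivrMr ?invr_gt0 ?powR_gt0// invrK mul1r.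
    by apply: ge0_ler_powR; rewrite ?nnegrE ?(ltW (Y0 j)) ?(ltW Y10) ?(ltW YjY1)//; lra.
  have D2 : D%:R + 2 <= A * Z * rho ^+ j.
    rewrite (_ : A * Z * rho ^+ j = A * Y j `^ (1 - p)); last by rewrite YZ; ring.
    by rewrite /A mulrDl; lra.
  have sg0 : 0 < sg by lra.
  exists (4 * (2 ^+ D * sg)).
    apply/andP; split.
      apply: (le_trans s0sg); rewrite mulrA ler_peMl ?(ltW sg0)//.
      have D1 : 1 <= 2 ^+ D :> R by rewrite exprn_ege1// ler1n.
      by rewrite (le_trans D1)// ler_peMl ?ler1n// (le_trans ler01).
    apply: (@le_trans _ _ (expR (ln 2 * (A * Z * rho ^+ j)) * sg)).
      rewrite mulrA ler_pM2r//.
      have -> : 4 * 2 ^+ D = expR (ln 2 * (D%:R + 2)) :> R.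
        rewrite mulrDr expRD mulrC expRM lnK ?posrE// powR_mulrn//; congr (_ * _).
        by rewrite mulrC (expRM_natl 2) lnK ?posrE//; ring.
      by rewrite ler_expR ler_pM2l.
    apply: le_trans (ler_wpM2l (expR_ge0 _) sgle) _.
    rewrite mulrCA -expRD -mulrDr; rewrite le_eqVlt; apply/orP; left; apply/eqP.
    congr (_ * expR (_ * _)); rewrite exprS; field.
    by rewrite subr_eq0 gt_eqF.
  have ksg : kap < sg by lra.
  have := Hstep T u (Y j) sg D su ksg (Y0 j) isT HY.
  move=> h x t tT sx xx; apply: le_trans (h x t tT sx xx).
  apply: ler_wpM2r; first exact: powR_ge0.
  apply: ler_wpM2r; first exact: powR_ge0.
  rewrite (_ : Y j.+1 = 2 * Y j); last by rewrite /Y exprS -mulrA.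
  have Ye : Y j = Y j `^ (1 - p) * Y j `^ p.
    rewrite -powRD; last by rewrite (gt_eqF (Y0 j)) implybT.
    by rewrite subrK (powRr1 (ltW (Y0 j))).
  rewrite {1}Ye mulrA; apply: ler_wpM2r; first exact: powR_ge0.
  by move: Dge; rewrite mulrAC ler_pdivrMr// [_ * c4]mulrC.
have [j [Hj jY]] : exists j, (forall i, (i < j)%N -> Y i < Y1) /\ Y1 <= Y j.
  have ex : exists j, Y1 <= Y j.
    exists (Num.truncn (Y1 / (cY * eps `^ p))).+1.
    rewrite -ler_pdivrMr//; apply: le_trans (ltW (truncnS_gt _)) _.
    by rewrite -natrX ler_nat ltnW// ltn_expl.
  exists (ex_minn ex); case: ex_minnP => j Hj jm; split => // i ij.
  by rewrite ltNge; apply/negP => /jm; rewrite leqNgt ij.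
have [sg /andP[s0sg sgle] HY] := main j Hj.
have ksg : kap < sg by lra.
apply: (le_trans (ltW (Hend T u (Y j) sg su ksg jY HY))).
apply: (@le_trans _ _ (32 * (s0 * expR (B * eps `^ (- (p * (p - 1))))))).
  rewrite ler_pM2l//; apply: le_trans sgle _; rewrite ler_pM2l// ler_expR /B.
  have ZE : Z = cY `^ (1 - p) * eps `^ (- (p * (p - 1))).
    rewrite /Z powRM ?powR_ge0 ?(ltW cY0)// -powRrM; congr (_ * _ `^ _); by ring.
  rewrite [leRHS](_ : _ = ln 2 * (A * Z / (1 - rho))); last by rewrite ZE; ring.
  rewrite (ler_pM2l ln20) [leLHS](_ : _ = A * Z / (1 - rho) * (1 - rho ^+ j)); last by ring.
  apply: ler_piMr; last by rewrite gerBl exprn_ge0// ltW.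
  apply: divr_ge0; last by rewrite subr_ge0 ltW.
  by apply: mulr_ge0; exact: ltW.
have E1 : 1 <= eps `^ (- (p * (p - 1))).
  rewrite powRN invf_ge1 ?powR_gt0// -[leRHS](powRr0 eps) ger_powR ?e0//.
  by apply: mulr_ge0; lra.
rewrite mulrA -{1}[32 * s0]lnK ?posrE ?mulr_gt0// -expRD ler_expR [leRHS]mulrDl.
apply: lerD => //; apply: le_trans (ler_norm _) _.
by rewrite ler_peMr.
Qed.

End Critical.

Section CriticalExponent.
Variables (R : realType) (n : nat) (p : R).
Hypotheses (n3 : (3 <= n)%N) (pgt1 : 1 < p).

Let disc := n%:R ^+ 2 + 2 * n%:R - 7 : R.

Lemma zeta_p1_factor : exists2 c : R, 0 < c &
  zeta p n = 2 * (n%:R - 2) * (p1 R n - p) * (p + c).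
Proof.
have n3R : 3 <= n%:R :> R by rewrite ler_nat.
have pp : 1 < p := pgt1.
have d0 : 0 <= disc by rewrite /disc; nra.
have ss : Num.sqrt disc ^+ 2 = disc by rewrite sqr_sqrtr.
have sgt : n%:R - 1 < Num.sqrt disc.
  have n1 : 0 <= n%:R - 1 :> R by lra.
  by rewrite -(@ltr_pXn2r _ 2)// ?nnegrE ?sqrtr_ge0 ?ss /disc//; nra.
pose c := (Num.sqrt disc - (n%:R - 1)) / (2 * (n%:R - 2)).
exists c; first by apply: divr_gt0; lra.
rewrite /c {c}.
rewrite /zeta /p1 (_ : n%:R ^+ 2 + 2 * n%:R - 7 = disc)//; move: (Num.sqrt disc) ss sgt => r ss sgt.
have n2 : n%:R - 2 != 0 :> R by rewrite gt_eqF//; lra.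
rewrite [RHS](_ : _ = ((r ^+ 2 - (n%:R - 1) ^+ 2) / (2 * (n%:R - 2)) +
   2 * ((n%:R - 1) * p - (n%:R - 2) * p ^+ 2))); last by field.
by rewrite ss /disc; field.
Qed.

Lemma zeta_gt0 : p < p1 R n -> 0 < zeta p n.
Proof.
have n3R : 3 <= n%:R :> R by rewrite ler_nat.
have pp : 1 < p := pgt1.
have [c c0 ->] := zeta_p1_factor => lt_p.
apply: mulr_gt0; last lra.
by apply: mulr_gt0; lra.
Qed.

Lemma zeta_eq0 : p = p1 R n -> p * ((n%:R - 2) * p - (n%:R - 1)) = 1.
Proof.
have [c _ ze] := zeta_p1_factor => pE; move: ze; rewrite -pE subrr mulr0 mul0r /zeta => ze.
lra.
Qed.

End CriticalExponent.

Lemma is_solution_bounds (R : realType) (n : nat) (p k k0 a b cV t0 eps T : R)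
    (g0 : R -> R) (u : 'rV[R]_n -> R -> R) :
  (3 <= n)%N -> 1 < p -> C2_halfline g0 -> 0 < k -> (forall r, k < r -> g0 r = 0) ->
  0 < k0 -> (forall r, k0 < r < k -> 0 < g0 r) -> 0 < eps -> 0 < t0 ->
  (forall (x : 'rV[R]_n) (t : R), t0 <= t -> a <= t - enorm x <= b ->
    cV / t ^+ (n - 2) <= Vlin (fun=> 0) (fun x => g0 (enorm x)) x t) ->
  is_solution p eps (fun=> 0) (fun x => g0 (enorm x)) T u ->
  supersolution p k0 (((n%:R - 2) * omega R n)^-1) T u /\
  strip_bound a b cV t0 eps T u.
Proof.
move=> n3 p1 Cg k_gt0 gk k0_gt0 gpos e0 t00 HV [reg uE].
have p0 : 0 <= p by apply: ltW; apply: lt_trans p1.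
have n0 : (0 < n)%N by exact: leq_trans n3.
have bG := regular_sol_bounded p0 reg.
have NE x t : Nop (fun y s => `|u y s| `^ p) x t =
  ((n%:R - 2) * omega R n)^-1 * retarded (fun y s => `|u y s| `^ p) x t by [].
have cN0 : 0 < ((n%:R - 2) * omega R n)^-1.
  by rewrite invr_gt0 mulr_gt0 ?omega_gt0// subr_gt0 ltr_nat.
split; first split => [x t tT|x t tT xt].
- exact: bG.
- rewrite uE// NE lerDr mulr_ge0 ?(ltW e0)//.
  by case/andP: tT => t_ge0 _; apply: (@Vlin_ge0 R g0 k k0).
move=> x t /andP[t0t tT] xt.
have t0T : 0 <= t <= T by rewrite tT andbT (le_trans (ltW t00)).
rewrite uE// NE; apply: ler_wpDr.
  by apply: mulr_ge0; [exact: ltW|apply: retarded_ge0 => //; exact: bG].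
by rewrite -mulrA ler_pM2l//; exact: HV.
Qed.

Unset Implicit Arguments.

Theorem theorem2p3 (R : realType) (n : nat) (p : R) (g0 : R -> R) (k k0 : R) :
  (3 <= n)%N -> 1 < p ->
  C2_halfline g0 ->
  0 < k -> (forall r, k < r -> g0 r = 0) ->
  0 < k0 -> k0 < k -> (forall r, k0 < r < k -> 0 < g0 r) ->
  exists2 eps0 : R, 0 < eps0 &
  exists2 C : R, 0 < C &
  forall eps : R, 0 < eps <= eps0 ->
    (p < p1 R n ->
       (lifespan p eps (fun _ : 'rV[R]_n => 0%R) (fun x => g0 (enorm x))
        <= (C * eps `^ (- (2 * p * (p - 1) / zeta p n)))%R%:E)%E) /\
    (p = p1 R n ->
       (lifespan p eps (fun _ : 'rV[R]_n => 0%R) (fun x => g0 (enorm x))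
        <= (expR (C * eps `^ (- (p * (p - 1)))))%R%:E)%E).
Proof.
move=> n3 pgt1 Cg k_gt0 gk k0_gt0 k0k gpos.
have [a [b [cV [t0 [k0a ab cV0 t00 HV]]]]] := Vlin_lower Cg k_gt0 gk k0_gt0 k0k gpos n3.
have cN0 : 0 < ((n%:R - 2) * omega R n)^-1.
  by rewrite invr_gt0 mulr_gt0 ?omega_gt0// subr_gt0 ltr_nat.
have sol eps T u (e0 : 0 < eps) := is_solution_bounds n3 pgt1 Cg k_gt0 gk k0_gt0 gpos e0 t00 HV
  (eps := eps) (T := T) (u := u).
exists 1 => //.
have [lt_p|gt_p|eq_p] := ltrgtP p (p1 R n).
- have [C C0 HC] := subcritical_lifespan n3 pgt1 k0_gt0 cN0 k0a ab cV0 t00 (zeta_gt0 n3 pgt1 lt_p).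
  exists C => // eps /andP[e0 e1]; split => [_|pE]; last by move: lt_p; rewrite pE ltxx.
  apply: ge_ereal_sup => _ [T [_ [u /(sol _ _ _ e0)[su strip]]] <-].
  by rewrite lee_fin; apply: HC su strip; rewrite e0.
- exists 1 => // eps _; split => [//|pE]; by move: gt_p; rewrite pE ltxx.
have [C C0 HC] := critical_lifespan n3 pgt1 k0_gt0 cN0 (zeta_eq0 n3 pgt1 eq_p) k0a ab cV0 t00.
exists C => // eps /andP[e0 e1]; split => // _.
apply: ge_ereal_sup => _ [T [_ [u /(sol _ _ _ e0)[su strip]]] <-].
by rewrite lee_fin; apply: HC su strip; rewrite e0.
Qed.
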